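(* Let $q\geq 0$ and $1\leq t\leq 2^q$ be integers and let $d=7\cdot 2^q-2t$. For any $2^{q+1}-1$ masses on $\mathbb{R}^d$, there exist four hyperplanes $H_1,H_2,H_3,H_4$ in $\mathbb{R}^d$ such that (i) any three of $H_1,H_2,H_3,H_4$ equipartition each of some prescribed $2^{q+1}-t$ of the masses, and (ii) any two of $H_2,H_3,H_4$ equipartition each of the remaining $t-1$ masses.
   Context: A mass on $\mathbb{R}^d$ is a finite Borel measure on $\mathbb{R}^d$ absolutely continuous with respect to Lebesgue measure. A hyperplane $H=\{\langle u,a\rangle=b\}$ ($a\neq0$) has closed half-spaces $H^+=\{\langle u,a\rangle\geq b\}$, $H^-=\{\langle u,a\rangle\leq b\}$. Hyperplanes $H_{i_1},\dots,H_{i_\ell}$ equipartition $\mu$ if each of the $2^\ell$ regions $H_{i_1}^{\pm}\cap\cdots\cap H_{i_\ell}^{\pm}$ has $\mu$-measure $\mu(\mathbb{R}^d)/2^\ell$. *)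

(* Defs.v *)
(* R^d is modelled as [d.-tuple R], which carries the
   product (= Borel) sigma-algebra provided by mathcomp-analysis. *)
From HB Require Import structures.
From mathcomp Require Import all_boot all_order all_algebra.
From mathcomp Require Import all_classical all_reals all_analysis.
Set Implicit Arguments. Unset Strict Implicit. Unset Printing Implicit Defensive.
Import Order.TTheory GRing.Theory Num.Theory.
Local Open Scope classical_set_scope.
Local Open Scope ring_scope.

Section Defs.
Variables (R : realType) (d : nat).

Definition dotp (u a : d.-tuple R) : R := \sum_(i < d) tnth u i * tnth a i.

Definition box (a b : 'I_d -> R) : set (d.-tuple R) :=
  [set u | forall i, a i <= tnth u i <= b i].
Definition box_vol (a b : 'I_d -> R) : R := \prod_(i < d) (b i - a i).

Definition lebesgue_null (A : set (d.-tuple R)) : Prop :=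
  forall eps : R, 0 < eps -> exists (a b : nat -> 'I_d -> R),
    [/\ (forall n i, a n i <= b n i),
        A `<=` \bigcup_n box (a n) (b n) &
        forall N, \sum_(n < N) box_vol (a n) (b n) <= eps].

Definition abs_continuous (mu : {finite_measure set (d.-tuple R) -> \bar R}) : Prop :=
  forall A, measurable A -> lebesgue_null A -> mu A = 0%E.

(* hyperplane {u | <u,a> = b}, given by (a, b); it is a genuine hyperplane
   when a <> 0 *)
Definition hyperplane := (d.-tuple R * R)%type.
Definition hp_nondeg (H : hyperplane) : Prop := exists i, tnth H.1 i != 0.

Definition halfspace (H : hyperplane) (s : bool) : set (d.-tuple R) :=
  if s then [set u | H.2 <= dotp u H.1] else [set u | dotp u H.1 <= H.2].

Definition equipartition (I : finType) (H : I -> hyperplane) (S : {set I})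
    (mu : {finite_measure set (d.-tuple R) -> \bar R}) : Prop :=
  forall s : I -> bool,
    mu [set u | forall i, i \in S -> halfspace (H i) (s i) u]
    = (mu setT * ((2 ^ #|S|)%:R)^-1%:E)%E.

End Defs.

(* Main.v *)
(** Parametrize hyperplanes by the cube [-1, 1]^d, a point a giving the normal
    vector a and the offset \prod_j (1 - a_j^2), and let the last i entries of
    the normal of H_i be zero (i = 0, ..., 3).  The 4d - 6 integrals of products of signs which must vanish
    for (i) and (ii) to hold are continuous functions on a product of cubes of
    dimensions d, d-1, d-2, d-3; on the boundary of the i-th cube, negating it
    negates the functions whose product involves H_i.  By a Borsuk-Ulam
    theorem for products of cubes they have a common zero as soon as the
    monomial x_0^d x_1^(d-1) x_2^(d-2) x_3^(d-3) has odd coefficient in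
    E^(2^(q+1)-t) F^(2^(q+1)-1), where F is the product of the six sums of one
    or two of x_1, x_2, x_3 and E that of the eight remaining sums of at most
    three of the x_i.  The coefficients close to that monomial are computed by
    induction on q, squaring being the Frobenius.  A Fourier expansion on
    (Z/2)^3 then turns vanishing integrals into equipartitions. *)
Require Import Defs.
From mathcomp Require Import all_boot all_order all_algebra all_fingroup.
From mathcomp Require Import all_classical all_reals all_analysis.
From mathcomp Require Import measurable_realfun.
From mathcomp Require Import zify lra.
Import Order.TTheory GRing.Theory Num.Theory.

Set Implicit Arguments.
Unset Strict Implicit.
Unset Printing Implicit Defensive.

(** * A combinatorial Borsuk-Ulam theorem *)

Lemma xor_involution (T : finType) (F : T -> bool) (g : T -> T) :
    involutive g -> (forall x, g x != x) -> (forall x, F (g x) = F x) ->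
  \big[addb/false]_x F x = false.
Proof.
move=> gK gN Fg; pose lt (x y : T) := enum_rank x < enum_rank y.
rewrite (bigID (fun x => lt x (g x))) /=.
rewrite [X in _ (+) X](reindex_inj (inv_inj gK)) /=.
rewrite [X in _ (+) X](eq_big (fun x => lt x (g x)) F) ?addbb // => x.
rewrite gK /lt -leqNgt leq_eqVlt orb_idl //.
by move=> /eqP /ord_inj /enum_rank_inj /eqP; rewrite eq_sym (negbTE (gN x)).
Qed.

Lemma xor_card (T : finType) (P : pred T) :
  \big[addb/false]_x P x = odd #|P|.
Proof.
rewrite -sum1_card (big_morph odd oddD (erefl _)) [RHS]big_mkcond /=.
by apply: eq_bigr => x _; rewrite unfold_in; case: (P x).
Qed.

Section Grid.

Variables (I : finType) (N n : nat) (be : 'I_N -> I).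

Definition gpoint := {ffun 'I_N -> nat}.

(* Grid points have coordinates in [0, 2n]: an even coordinate is a vertex of
   the subdivision of the edge into n cells, an odd one the midpoint of a cell.
   A flag is a cell, a corner of it and an ordering of the coordinates; its
   vertices [vtx f 0, ..., vtx f N] are the barycentres of a full chain of
   faces of the cell, from the corner up to the cell itself. *)
Definition flag :=
  ({ffun 'I_N -> 'I_n} * {ffun 'I_N -> bool} * 'S_N)%type.

Definition vtx (f : flag) (m : nat) : gpoint :=
  [ffun i => if f.2 i < m then (f.1.1 i).*2.+1 else (f.1.1 i + f.1.2 i).*2].

Definition bd (v : nat) := (v == 0) || (v == n.*2).

Definition tau (B : I) (x : gpoint) : gpoint :=
  [ffun i => if be i == B then n.*2 - x i else x i].

Definition onbd (B : I) (x : gpoint) := [exists i, (be i == B) && bd (x i)].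

(** The signs of a section of the real line bundle with class [\sum_(B in A) x_B], over the product
    of the projective spaces obtained from the cubes by identifying antipodal boundary points. *)
Definition equivariant (s : gpoint -> bool) (A : {set I}) :=
  forall B (x : gpoint), (forall i, x i <= n.*2) -> onbd B x -> s (tau B x) = s x (+) (B \in A).

Lemma vtx_le f m i : vtx f m i <= n.*2.
Proof. by rewrite ffunE; have := ltn_ord (f.1.1 i); case: ifP; case: (f.1.2 i); lia. Qed.

(** The neighbouring flag across the face opposite to vertex [k]. For [k = 0] the corner moves along
    the coordinate of rank 0; for [k > 0] the coordinates of ranks [k - 1] and [k] are exchanged,
    which alters the set of coordinates of rank below [m] only for [m = k]. *)
Lemma flip_lower k : k < N -> exists g : flag -> flag,
  [/\ involutive g, forall f, g f != f
    & forall f m, m != k -> vtx (g f) m = vtx f m].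
Proof.
case: k => [|k] ltk.
  pose i0 (r : 'S_N) := (r^-1)%g (Ordinal ltk).
  exists (fun f : flag => (f.1.1, [ffun i => f.1.2 i (+) (i == i0 f.2)], f.2)); split.
  - move=> [[c e] r] /=; congr (_, _, _); apply/ffunP => i; rewrite !ffunE.
    by rewrite -addbA addbb addbF.
  - move=> [[c e] r]; apply/eqP => -[] /ffunP /(_ (i0 r)).
    by rewrite !ffunE eqxx; case: (e _).
  - move=> [[c e] r] m m0; apply/ffunP => i; rewrite !ffunE /=.
    case: ifP => // rm; case: eqP => [ii|_]; last by rewrite addbF.
    by move: rm; rewrite ii permKV /= lt0n m0.
have ltk' : k < N by exact: ltnW.
pose t : 'S_N := tperm (Ordinal ltk') (Ordinal ltk).
exists (fun f => (f.1, (f.2 * t)%g)); split.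
- by move=> [a r] /=; rewrite -mulgA tperm2 mulg1.
- move=> [a r]; apply/eqP => -[] /permP /(_ ((r^-1)%g (Ordinal ltk))).
  by rewrite permM permKV tpermR => /(congr1 val) /= ?; lia.
- move=> [a r] m mk; apply/ffunP => i; rewrite !ffunE /= permM.
  suff -> : (t (r i) < m) = (r i < m) by [].
  by case: tpermP => [->|->|] //=; lia.
Qed.

Definition tauf (B : I) (f : flag) : flag :=
  ([ffun i => if be i == B then rev_ord (f.1.1 i) else f.1.1 i],
   [ffun i => f.1.2 i (+) (be i == B)], f.2).

Lemma vtx_tauf B f m : vtx (tauf B f) m = tau B (vtx f m).
Proof.
apply/ffunP => i; rewrite !ffunE /=.
have := ltn_ord (f.1.1 i); case: (be i == B) => /=; last by rewrite addbF.
by case: (f.2 i < m); case: (f.1.2 i) => /=; lia.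
Qed.

Lemma taufK B : involutive (tauf B).
Proof.
move=> [[c e] r]; congr (_, _, _); apply/ffunP => i; rewrite !ffunE /=.
  by case: (be i == B); rewrite ?rev_ordK.
by rewrite -addbA addbb addbF.
Qed.

Definition cross (b : bool) (c : 'I_n) : 'I_n :=
  if b then insubd c c.+1 else insubd c c.-1.

Lemma val_cross (b : bool) (c : 'I_n) : bd (c + b).*2 = false ->
  (cross b c : nat) = if b then c.+1 else c.-1.
Proof.
rewrite /bd /cross; have := ltn_ord c; case: b => /= hc hb; rewrite val_insubd ifT //; lia.
Qed.

Lemma crossK (b : bool) (c : 'I_n) : bd (c + b).*2 = false ->
  cross (~~ b) (cross b c) = c.
Proof.
move=> h; apply: val_inj; have := val_cross h; move: (cross b c) => c' E.
have := ltn_ord c; have := ltn_ord c'; rewrite /= val_cross; move: h;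
by rewrite /bd; case: b E => /= ->; lia.
Qed.

(** Without its last vertex a flag lies in the facet of its cell that fixes the coordinate of rank
    [N - 1]. The partner is the flag of the neighbouring cell ([crf]); when the facet lies on the
    boundary of a cube there is no such cell, and the antipodal flag ([tauf]) takes its place. *)
Lemma flip_upper : 0 < N -> exists g : flag -> flag,
  [/\ involutive g, forall f, g f != f
    & forall f, (forall m, m < N -> vtx (g f) m = vtx f m) \/
        exists B, forall m, m < N ->
          onbd B (vtx f m) /\ vtx (g f) m = tau B (vtx f m)].
Proof.
move=> N0; have ltk : N.-1 < N by rewrite prednK.
pose i0 (f : flag) := (f.2^-1)%g (Ordinal ltk).
pose isbd (f : flag) := bd (f.1.1 (i0 f) + f.1.2 (i0 f)).*2.
pose crf (f : flag) : flag :=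
  ([ffun i => if i == i0 f then cross (f.1.2 i) (f.1.1 i) else f.1.1 i],
   [ffun i => f.1.2 i (+) (i == i0 f)], f.2).
have i0t B f : i0 (tauf B f) = i0 f by [].
have i0c f : i0 (crf f) = i0 f by [].
have crE f : isbd f = false ->
   (f.1.1 (i0 f) + f.1.2 (i0 f)) =
   ((crf f).1.1 (i0 f) + (crf f).1.2 (i0 f)).
  move=> fb; rewrite /crf /= !ffunE eqxx.
  rewrite val_cross //; move: fb; rewrite /isbd /bd.
  by case: (f.1.2 _) => /=; lia.
exists (fun f : flag => if isbd f then tauf (be (i0 f)) f else crf f); split.
- move=> f; case fb: (isbd f).
    rewrite ifT ?i0t ?taufK // /isbd i0t /= !ffunE eqxx.
    move: fb; rewrite /isbd /bd; have := ltn_ord (f.1.1 (i0 f)).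
    by case: (f.1.2 _) => /=; lia.
  rewrite ifF; last by rewrite /isbd i0c -crE.
  case: f fb => [[c e] r] fb.
  rewrite {1}/crf i0c; congr (_, _, _); apply/ffunP => i; rewrite !ffunE /=;
    last by rewrite -addbA addbb addbF.
  case: (altP (i =P i0 (c, e, r))) => [->|ni] //.
  by rewrite addbT crossK.
- move=> f; apply/eqP; case: (isbd f) => /(congr1 (fun g : flag => g.1.2)) /ffunP /(_ (i0 f));
  by rewrite !ffunE eqxx; case: (f.1.2 _).
- move=> f; case fb: (isbd f); [right|left].
    exists (be (i0 f)) => m mN; split; last exact: vtx_tauf.
    apply/existsP; exists (i0 f); rewrite eqxx ffunE ifN //= permKV /= -leqNgt.
    lia.
  move=> m mN; apply/ffunP => i; rewrite !ffunE.
  case: (altP (i =P i0 f)) => [->|ni]; last by rewrite addbF.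
  rewrite /= permKV /= ltnNge -ltnS prednK // mN /=.
  by have := crE _ fb; rewrite /crf /= !ffunE eqxx => <-.
Qed.

Lemma xor_flip_lower k (F : flag -> bool) : k < N ->
  (forall f g : flag, (forall m, m != k -> vtx g m = vtx f m) -> F g = F f) ->
  \big[addb/false]_f F f = false.
Proof.
move=> kN Fk; have [g [gK gN gv]] := flip_lower kN.
by apply: (xor_involution gK gN) => f; apply: Fk => m; apply: gv.
Qed.

(** * Independence of the flag count from the choice of labels *)

Section Labels.

Variables (s : nat -> gpoint -> bool) (al : nat -> {set I}).
Hypothesis s_eqv : forall l, l < N -> equivariant (s l) (al l).

(** The cup product of the coboundaries of the labels, evaluated on the sum of all flags: the parity
    of the number of flags along which every label [l] changes between the vertices [l] and
    [l + 1]. *)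
Definition sgn_sum (s : nat -> gpoint -> bool) :=
  \big[addb/false]_(f : flag)
    \big[andb/true]_(l < N) (s l (vtx f l) (+) s l (vtx f l.+1)).

Variables (b : gpoint -> bool) (j : nat).
Hypotheses (b_inv : equivariant b finset.set0) (jN : j < N).

Let term k (p : nat -> nat) (f : flag) :=
  b (vtx f k) && \big[andb/true]_(l < N | (l : nat) != j)
     (s l (vtx f (p l)) (+) s l (vtx f (p l).+1)).

(* The summed face of [vtx f 0 ... vtx f N] opposite to [vtx f i] is invariant
   under the involution moving only [vtx f i].  Telescoping these relations
   over i, as in the Leibniz rule, shows that a coboundary sums to zero. *)
Let xor_term_step k p p' i l0 : i < N -> k != i -> l0 < N -> l0 != j ->
    (p l0).+1 = i -> p' l0 = i ->
    (forall l, l < N -> l != l0 -> l != j -> p l = p' l /\ p l != i /\ (p l).+1 != i) ->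
  \big[addb/false]_f term k p f = \big[addb/false]_f term k p' f.
Proof.
move=> iN ki l0N l0j pi p'i pp.
suff : \big[addb/false]_f (term k p f (+) term k p' f) = false.
  rewrite big_split /=; case: (\big[addb/false]_f term k p f);
  by case: (\big[addb/false]_f term k p' f).
pose l1 := Ordinal l0N.
pose rest f := b (vtx f k) && \big[andb/true]_(l < N | ((l : nat) != j) && (l != l1))
     (s l (vtx f (p l)) (+) s l (vtx f (p l).+1)).
apply: (@xor_flip_lower i) => // f g fg.
have E h : term k p h (+) term k p' h =
    rest h && (s l0 (vtx h (p l0)) (+) s l0 (vtx h i.+1)).
  rewrite /term (bigD1 l1) //= [in X in _ (+) X](bigD1 l1) //= /rest pi p'i.
  rewrite (eq_bigr (fun l : 'I_N => s l (vtx h (p' l)) (+) s l (vtx h (p' l).+1))); last first.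
    by move=> l /andP[lj ll]; have [//|->] := pp l (ltn_ord l) _ lj.
  case: (b _) => //=; case: (\big[andb/true]_(l < N | _) _); rewrite ?andbF ?andbT //.
  by case: (s _ _) (s _ (vtx h i)) (s _ (vtx h i.+1)) => [] [] [].
rewrite !E /rest !fg; try lia.
congr (_ && _ && _); apply: eq_bigr => l /andP[lj ll].
by have [//|_ [? ?]] := pp l (ltn_ord l) _ lj; rewrite !fg.
Qed.

Let eq_term k p p' : (forall l, l < N -> l != j -> p l = p' l) ->
  \big[addb/false]_f term k p f = \big[addb/false]_f term k p' f.
Proof.
move=> pp; apply: eq_bigr => f _; rewrite /term; congr (_ && _).
by apply: eq_bigr => l lj; rewrite pp.
Qed.

(** The edges below [j] are moved up by one, starting with the edge [j - 1]. Once all are moved,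
    vertex 0 is absent from the product and [flip_lower] cancels the flags in pairs. *)
Let xor_term_left : \big[addb/false]_f term j.+1 id f = false.
Proof.
pose p i l := if (i <= l) && (l < j) then l.+1 else l.
suff left i : i <= j -> \big[addb/false]_f term j.+1 (p i) f = false.
  apply: etrans (left j (leqnn j)); apply: eq_term => l _ lj; rewrite /p.
  by case: ifP => // ?; lia.
elim: i => [|i IH] ij.
  apply: (@xor_flip_lower 0) => [|f g fg]; first lia.
  rewrite /term fg //; congr (_ && _); apply: eq_bigr => l lj.
  by rewrite /p; case: ifP => h; rewrite !fg //; lia.
apply: etrans (IH (ltnW ij)).
apply: (@xor_term_step j.+1 (p i.+1) (p i) i.+1 i) => //; rewrite /p; try lia.
- by case: ifP; lia.
- by case: ifP; lia.
- by move=> l lN li lj; do 2!case: ifP => ?; lia.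
Qed.

(** The edges above [j] are moved down by one until vertex [N] is absent, and [flip_upper] pairs the
    flags. Passing to the antipode leaves [b] unchanged and changes both labels of a factor or
    neither, so paired products agree. *)
Let xor_term_right : \big[addb/false]_f term j id f = false.
Proof.
pose p i l := if (j < l) && (l < i) then l.-1 else l.
suff right k : k < N - j -> \big[addb/false]_f term j (p (N - k)) f = false.
  apply: etrans (right (N - j.+1) _); last lia.
  apply: eq_term => l lN lj; rewrite /p; case: ifP => // ?; lia.
elim: k => [_|k IH kN].
  have [|g [gK gN gv]] := flip_upper; first lia.
  apply: (xor_involution gK gN) => f; rewrite /term subn0.
  case: (gv f) => [e|[B eB]].
    rewrite e //; congr (_ && _); apply: eq_bigr => l lj.
    by have := ltn_ord l; rewrite /p; case: ifP => h lN; rewrite !e //; lia.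
  have bg : b (vtx (g f) j) = b (vtx f j).
    have [h ->] := eB j jN; rewrite (b_inv _ h) ?finset.in_set0 ?addbF //.
    exact: vtx_le.
  rewrite bg; congr (_ && _); apply: eq_bigr => l lj.
  have sg m : m < N -> s l (vtx (g f) m) = s l (vtx f m) (+) (B \in al l).
    by move=> /eB [h ->]; apply: s_eqv h => // i; exact: vtx_le.
  have := ltn_ord l; rewrite /p => lN; case: ifP => h; rewrite !sg; lia.
apply: etrans (IH _); last lia.
symmetry; apply: (@xor_term_step j (p (N - k)) (p (N - k.+1)) (N - k.+1) (N - k.+1)) => //; rewrite /p; try lia.
- by case: ifP; lia.
- by case: ifP; lia.
- by move=> l lN li lj; do 2!case: ifP => ?; lia.
Qed.

Lemma xor_coboundary : \big[addb/false]_f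
    ((b (vtx f j) (+) b (vtx f j.+1)) && \big[andb/true]_(l < N | (l : nat) != j)
     (s l (vtx f l) (+) s l (vtx f l.+1))) = false.
Proof.
transitivity (\big[addb/false]_f (term j id f (+) term j.+1 id f)).
  by apply: eq_bigr => f _; rewrite andb_addl.
by rewrite big_split /= xor_term_left xor_term_right.
Qed.

End Labels.

(** The labels [s j] and [s' j] change in the same way on the boundaries, so their difference [b] is
    invariant there and its coboundary contributes nothing. *)
Lemma sgn_sum_step (s s' : nat -> gpoint -> bool) (al : nat -> {set I}) j :
    (forall l, l < N -> equivariant (s l) (al l)) ->
    equivariant (s' j) (al j) -> (forall l, l != j -> s l = s' l) -> j < N ->
  sgn_sum s = sgn_sum s'.
Proof.
move=> s_eqv s'_eqv ss jN; pose b x := s j x (+) s' j x.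
have b_inv : equivariant b finset.set0.
  move=> B x lx hx; rewrite /b s_eqv // s'_eqv // finset.in_set0 addbF.
  by rewrite addbACA addbb addbF.
have := xor_coboundary s_eqv b_inv jN.
set S := \big[_/_]_f _; suff -> : S = sgn_sum s (+) sgn_sum s'.
  by case: (sgn_sum s); case: (sgn_sum s').
rewrite -big_split /=; apply: eq_bigr => f _.
have D (r : nat -> gpoint -> bool) : (forall l, l != j -> r l = s l) ->
    \big[andb/true]_(l < N) (r l (vtx f l) (+) r l (vtx f l.+1)) =
    (r j (vtx f j) (+) r j (vtx f j.+1)) && \big[andb/true]_(l < N | (l : nat) != j)
      (s l (vtx f l) (+) s l (vtx f l.+1)).
  move=> rs; rewrite (bigD1 (Ordinal jN)) //=; congr (_ && _).
  by apply: eq_bigr => l lj; rewrite rs.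
rewrite !D //; last by move=> l lj; rewrite ss.
by rewrite -andb_addl /b addbACA.
Qed.

Lemma sgn_sum_eqv (s s' : nat -> gpoint -> bool) (al : nat -> {set I}) :
    (forall l, l < N -> equivariant (s l) (al l)) ->
    (forall l, l < N -> equivariant (s' l) (al l)) ->
  sgn_sum s = sgn_sum s'.
Proof.
move=> s_eqv s'_eqv; pose u k l := if l < k then s' l else s l.
suff h k : k <= N -> sgn_sum s = sgn_sum (u k).
  rewrite (h N) //; apply: eq_bigr => f _; apply: eq_bigr => l _.
  by rewrite /u ltn_ord.
elim: k => // k IH kN; rewrite (IH (ltnW kN)).
apply: (@sgn_sum_step _ _ al k) => //.
- by move=> l lN; rewrite /u; case: ifP => _; [apply: s'_eqv|apply: s_eqv].
- by rewrite /u ltnSn; apply: s'_eqv.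
- by move=> l lk; rewrite /u ltnS [l <= k]leq_eqVlt (negbTE lk).
Qed.

(** * Evaluation of the flag count on explicit labels *)

Section Corners.

Hypothesis n_gt0 : 0 < n.

(** The sign of the last boundary coordinate in block [B], and false in the interior of the cube: an
    equivariant label simple enough for its alternating flags to be listed. *)
Definition sig (B : I) (x : gpoint) :=
  [exists i, [&& be i == B, x i == n.*2 &
    [forall k : 'I_N, (i < k) && (be k == B) ==> ~~ bd (x k)]]].

Lemma sig_last B (x : gpoint) i : be i = B -> bd (x i) ->
    (forall k : 'I_N, i < k -> be k = B -> ~~ bd (x k)) ->
  sig B x = (x i == n.*2).
Proof.
move=> iB xi hi; apply/existsP/idP => [[k /and3P[/eqP kB xk /forallP hk]]|xin].
  have bk : bd (x k) by rewrite /bd xk orbT.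
  case: (ltngtP i k) => [ik|ki|/val_inj ->//].
    by have := hi _ ik kB; rewrite bk.
  by have := hk i; rewrite ki iB eqxx xi.
exists i; rewrite iB eqxx xin /=; apply/forallP => k; apply/implyP => /andP[ik /eqP kB].
exact: hi.
Qed.

Lemma sig_none B (x : gpoint) : (forall i, be i = B -> ~~ bd (x i)) -> sig B x = false.
Proof.
move=> h; apply/existsP => -[k /and3P[/eqP kB xk _]].
by have := h _ kB; rewrite /bd xk orbT.
Qed.

Lemma last_bd B (x : gpoint) : onbd B x -> exists i, [/\ be i = B, bd (x i) &
    forall k : 'I_N, i < k -> be k = B -> ~~ bd (x k)].
Proof.
case/existsP => i0 Pi0; have [i /andP[/eqP iB xi] imax] :=
  @arg_maxnP _ i0 (fun i => (be i == B) && bd (x i)) val Pi0.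
exists i; split => // k ik kB; apply/negP => xk.
by have := imax k; rewrite kB eqxx xk => /(_ isT); rewrite /= leqNgt ik.
Qed.

Lemma eq_sig B (x y : gpoint) :
    (forall i, be i = B -> x i = y i \/ ~~ bd (x i) && ~~ bd (y i)) -> sig B x = sig B y.
Proof.
move=> xy; apply: eq_existsb => i.
case: (altP (be i =P B)) => //= iB; congr (_ && _).
  have z v : ~~ bd v -> (v == n.*2) = false by rewrite /bd negb_or => /andP[_ /negbTE].
  by case: (xy i iB) => [->//|/andP[hx hy]]; rewrite !z.
apply: eq_forallb => k; case: (altP (be k =P B)) => [kB|]; last by rewrite !andbF.
by case: (xy k kB) => [->//|/andP[-> ->]].
Qed.

Lemma sig_eqv B : equivariant (sig B) [set B].
Proof.
move=> C x lx hx; rewrite finset.in_set1; case: (altP (C =P B)) => [eCB|nCB]; last first.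
  rewrite addbF; apply: eq_sig => i iB; left; rewrite ffunE iB.
  by rewrite eq_sym (negbTE nCB).
have bdt i : be i = C -> bd (tau C x i) = bd (x i).
  by move=> iC; rewrite ffunE iC eqxx /bd; have := lx i; lia.
subst C; have [i [iB xi hi]] := last_bd hx.
rewrite (sig_last iB xi hi) (sig_last iB).
- by rewrite ffunE iB eqxx; have := lx i; move: xi; rewrite /bd; lia.
- by rewrite bdt.
- by move=> k ik kB; rewrite bdt // hi.
Qed.

Definition sigs (A : {set I}) (x : gpoint) := \big[addb/false]_(B in A) sig B x.

Lemma sigs_eqv A : equivariant (sigs A) A.
Proof.
move=> C x lx hx; rewrite /sigs.
rewrite (eq_bigr (fun B => sig B x (+) (C == B))); last first.
  by move=> B _; rewrite sig_eqv // finset.in_set1.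
rewrite big_split /=; congr (_ (+) _); case CA: (C \in A).
  rewrite (bigD1 C) //= eqxx big1 // => B /andP[_ BC].
  by rewrite eq_sym (negbTE BC).
by rewrite big1 // => B BA; apply: contraTF BA => /eqP <-; rewrite CA.
Qed.

Section GoodFlags.

Variable al : nat -> {set I}.

Definition flips (f : flag) i :=
  sig (be i) (vtx f (f.2 i)) (+) sig (be i) (vtx f (f.2 i).+1).

Definition good (f : flag) := [forall i, (be i \in al (f.2 i)) && flips f i].

Lemma vtxS_neq f i k : k != i -> vtx f (f.2 i).+1 k = vtx f (f.2 i) k.
Proof.
move=> ki; rewrite !ffunE ltnS leq_eqVlt; case: eqP => //= /val_inj /perm_inj E.
by rewrite E eqxx in ki.
Qed.

(** Between the vertices [f.2 i] and [f.2 i + 1] only the coordinate [i] moves, so only the sign of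
    its own block can change. The product over steps thus becomes a product over coordinates. *)
Lemma sgn_sum_sigs : sgn_sum (fun l => sigs (al l)) = odd #|good|.
Proof.
rewrite -xor_card; apply: eq_bigr => f _.
rewrite (reindex_inj (@perm_inj _ f.2)) /=.
have -> : good f = \big[andb/true]_i ((be i \in al (f.2 i)) && flips f i).
  by rewrite big_andE.
apply: eq_bigr => i _.
rewrite /sigs -big_split /=.
case bA: (be i \in _) => /=; last first.
  apply: big1 => B BA; rewrite (@eq_sig B _ (vtx f (f.2 i).+1)) ?addbb // => k kB.
  left; rewrite vtxS_neq //; apply: contraTneq BA => ki.
  by rewrite -kB ki bA.
rewrite (bigD1 (be i)) //= big1 ?addbF // => B /andP[BA Bi].
rewrite (@eq_sig B _ (vtx f (f.2 i).+1)) ?addbb // => k kB.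
left; rewrite vtxS_neq //; apply: contraNneq Bi => ki.
by rewrite -kB ki.
Qed.

Definition corner (f : flag) (i : 'I_N) : nat := f.1.1 i + f.1.2 i.

Definition par (i : 'I_N) := odd #|[set k : 'I_N | (k < i) && (be k == be i)]|.

Definition decr (f : flag) := forall i k : 'I_N, i < k -> be i = be k -> f.2 k < f.2 i.

Lemma vtx_gt (f : flag) (m : nat) (i : 'I_N) : f.2 i < m -> ~~ bd (vtx f m i).
Proof. by move=> h; rewrite ffunE h /bd; lia. Qed.

Lemma vtx_leq (f : flag) (m : nat) (i : 'I_N) : m <= f.2 i -> vtx f m i = (corner f i).*2.
Proof. by rewrite ffunE ltnNge => ->. Qed.

Lemma bd_double v : bd v.*2 = (v == 0) || (v == n).
Proof. by rewrite /bd; lia. Qed.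

(** In decreasing order, the later coordinates of the block are already interior when [i] moves.
    Hence [sig] reads coordinate [i] before the move, and after it the predecessor [p] of [i] in the
    block, if there is one. *)
Lemma flips_decr (f : flag) (i : 'I_N) : (forall k, bd (corner f k).*2) -> decr f ->
  (exists p : 'I_N, [/\ p < i, par i = ~~ par p &
     flips f i = (corner f i == n) (+) (corner f p == n)]) \/
  (par i = false /\ flips f i = (corner f i == n)).
Proof.
move=> hbd hdec.
have s0 : sig (be i) (vtx f (f.2 i)) = (corner f i == n).
  rewrite (@sig_last _ _ i) ?vtx_leq //; first by lia.
  by move=> k ik kB; rewrite vtx_gt // hdec.
rewrite /flips s0.
case: (pickP (fun k : 'I_N => (k < i) && (be k == be i))) => [k0 Pk0|none]; last first.
  right; split.
    rewrite /par (_ : [set _ | _] = finset.set0) ?finset.cards0 //.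
    by apply/setP => k; rewrite finset.in_set0 inE none.
  rewrite sig_none ?addbF // => k kB; rewrite vtx_gt //.
  case: (ltngtP i k) => [ik|ki|/val_inj ->//].
    by rewrite ltnS ltnW // hdec.
  by have := none k; rewrite /= ki kB eqxx.
have [p /andP[pi /eqP pB] pmax] := 
  @arg_maxnP _ k0 (fun k : 'I_N => (k < i) && (be k == be i)) val Pk0.
left; exists p; split => //.
  rewrite /par (_ : [set _ | _] = p |: [set k : 'I_N | (k < p) && (be k == be p)]).
    by rewrite cardsU1 inE ltnn.
  apply/setP => k; rewrite !inE pB; case: (altP (k =P p)) => [->|kp] /=.
    by rewrite pi pB eqxx.
  apply/andP/andP => -[h kB]; split => //; last exact: ltn_trans pi.
  have := pmax k; rewrite h kB => /(_ isT) /= ?.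
  by rewrite ltn_neqAle; apply/andP; split.
congr (_ (+) _); rewrite (@sig_last _ _ p) ?vtx_leq // ?hdec //; first by lia.
move=> k pk kB; rewrite vtx_gt // ltnS.
case: (ltngtP i k) => [ik|ki|/val_inj ->//].
  by rewrite ltnW // hdec.
by have := pmax k; rewrite /= ki kB eqxx leqNgt pk => /(_ isT).
Qed.

Definition canonical (f : flag) :=
  [/\ forall i, be i \in al (f.2 i), decr f
    & forall i, corner f i = if par i then 0 else n].

(** A corner off the boundary, or a later coordinate of the block still on the boundary, would hide
    the move of a coordinate from [sig]. This forces the order within each block and then, by
    induction along the block, corners that alternate between [n] and 0, beginning at [n]. *)
Lemma goodP f : reflect (canonical f) (good f).
Proof.
apply: (iffP idP) => [/forallP gf|[h0 h1 h2]]; last first.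
  have hb k : bd (corner f k).*2 by rewrite h2 /bd; case: ifP; lia.
  apply/forallP => i; rewrite h0 /=.
  have e k : (corner f k == n) = ~~ par k by rewrite h2; case: ifP; lia.
  case: (flips_decr i hb h1) => [[p [_ pp ->]]|[pp ->]]; rewrite !e pp //.
  by case: (par p).
have hb k : bd (corner f k).*2.
  have /andP[_] := gf k; apply: contraTT => h; rewrite /flips.
  rewrite (@eq_sig _ _ (vtx f (f.2 k).+1)) ?addbb // => i _.
  have [->|ik] := altP (i =P k); last by left; rewrite vtxS_neq.
  by right; rewrite vtx_leq // h vtx_gt.
have hd : decr f.
  move=> i k ik bik; rewrite ltnNge; apply/negP => le_ik.
  have {}le_ik : f.2 i < f.2 k.
    rewrite ltn_neqAle le_ik andbT; apply: contraTneq ik => /val_inj /perm_inj ->.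
    by rewrite ltnn.
  have /andP[_] := gf i; rewrite /flips.
  have : onbd (be i) (vtx f (f.2 i).+1).
    by apply/existsP; exists k; rewrite bik eqxx vtx_leq ?hb.
  case/last_bd => m [mB bm hm].
  have im : i < m.
    rewrite (leq_trans ik) // leqNgt; apply/negP => mk.
    by have := hm k mk; rewrite -bik vtx_leq // hb => /(_ erefl).
  have ne (k' : 'I_N) : i < k' -> vtx f (f.2 i).+1 k' = vtx f (f.2 i) k'.
    by move=> h; rewrite vtxS_neq //; apply: contraTneq h => ->; rewrite ltnn.
  rewrite (sig_last mB bm hm) (@sig_last _ _ m) -?ne ?addbb // => k' mk' Bk'.
  by rewrite -ne ?hm // (ltn_trans im).
split => // [i|i]; first by have /andP[] := gf i.
have [m] := ubnP (val i); elim: m i => // m IH i /= im.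
have e k : (corner f k == n) = ~~ par k -> corner f k = if par k then 0 else n.
  by have := hb k; rewrite bd_double; case: (par k); case: (corner f k =P n) => //= _; rewrite orbF => /eqP.
apply: (e); have /andP[_] := gf i.
case: (flips_decr i hb hd) => [[p [pi -> ->]]|[-> ->]] //.
rewrite (IH p); last exact: leq_trans pi im.
by case: (par p) => /=; rewrite ?eqxx ?(gtn_eqF n_gt0) ?(ltn_eqF n_gt0); case: eqP.
Qed.

(** * Bijection between good flags and words *)

Definition word (f : flag) : {ffun 'I_N -> I} := [ffun l => be (f.2^-1 l)%g].

Definition words : {set {ffun 'I_N -> I}} :=
  [set w : {ffun 'I_N -> I} | [forall l : 'I_N, w l \in al l] &&
     [forall B, #|[set l | w l == B]| == #|[set i | be i == B]|]].

Definition rank (r : rel 'I_N) (w : 'I_N -> I) i :=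
  #|[set k | r k i && (w k == w i)]|.

Lemma rank_lt (r : rel 'I_N) w i k : irreflexive r -> transitive r ->
  r i k -> w i = w k -> rank r w i < rank r w k.
Proof.
move=> rI rT ik wik; apply: proper_card; apply/fintype.properP; split.
  apply/fintype.subsetP => m; rewrite !inE wik => /andP[mi ->].
  by rewrite (rT _ _ _ mi ik).
by exists i; rewrite !inE ?ik ?wik ?eqxx // rI.
Qed.

Lemma rank_ltn_lt (w : 'I_N -> I) (i k : 'I_N) : i < k -> w i = w k ->
  rank (fun a b => a < b) w i < rank (fun a b => a < b) w k.
Proof.
move=> ik wik; apply: (rank_lt _ _ ik wik) => [a /=|a b c /=]; [exact: ltnn|].
exact: ltn_trans.
Qed.

Lemma rank_gtn_lt (w : 'I_N -> I) (i k : 'I_N) : k < i -> w i = w k ->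
  rank (fun a b => b < a) w i < rank (fun a b => b < a) w k.
Proof.
move=> ik wik; apply: (rank_lt _ _ ik wik) => [a /=|a b c /=]; [exact: ltnn|].
by move=> h1 h2; apply: ltn_trans h1.
Qed.

Lemma rank_gtn_inj (w : 'I_N -> I) i k : w i = w k ->
  rank (fun a b => b < a) w i = rank (fun a b => b < a) w k -> i = k.
Proof.
move=> wik rik; case: (ltngtP i k) => [ik|ki|/val_inj //].
  by have := rank_gtn_lt ik (esym wik); rewrite rik ltnn.
by have := rank_gtn_lt ki wik; rewrite rik ltnn.
Qed.

(** The occurrences of a letter, from left to right, are the coordinates of its block from the last
    to the first; this recovers the ordering of a good flag from its word. *)
Lemma rank_word f i : decr f ->
  rank (fun a b => a < b) (word f) (f.2 i) = rank (fun a b => b < a) be i.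
Proof.
move=> fd; rewrite /rank -[RHS](card_imset _ (@perm_inj _ f.2)).
apply: eq_card => l; rewrite inE; apply/idP/imsetP => [|[k]].
  rewrite !ffunE permK => /andP[li bl]; exists ((f.2^-1)%g l); last by rewrite permKV.
  rewrite inE bl andbT; move: li; rewrite -{1}[l](permKV f.2).
  case: (ltngtP i ((f.2^-1)%g l)) => // [h|/val_inj <-]; last by rewrite ltnn.
  by have := fd _ _ h (eqP bl); lia.
rewrite inE => /andP[ik bk] ->; rewrite !ffunE !permK bk andbT.
by apply: fd => //; apply/esym/eqP.
Qed.

Lemma word_inj : {in good &, injective word}.
Proof.
move=> f g /goodP[_ fd fc] /goodP[_ gd gc] fg.
have e2 : f.2 = g.2.
  apply/permP => i; apply: (@perm_inj _ (g.2^-1)%g); rewrite permK.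
  have wi : be ((g.2^-1)%g (f.2 i)) = be i.
    by have /ffunP/(_ (f.2 i)) := fg; rewrite !ffunE permK.
  apply: (rank_gtn_inj wi).
  by rewrite -(rank_word _ gd) permKV -fg (rank_word _ fd).
have ec i : corner f i = corner g i by rewrite fc gc.
have e1 i : f.1.1 i = g.1.1 i /\ f.1.2 i = g.1.2 i.
  have := ec i; have := fc i; rewrite /corner.
  have := ltn_ord (f.1.1 i); have := ltn_ord (g.1.1 i).
  case: (f.1.2 i); case: (g.1.2 i) => /= h1 h2 h3 h4; split => //;
    try apply: val_inj; move: h3 => /=; case: (par i) => ?; lia.
case: f g e2 e1 {fd gd fc gc fg ec} => [[c e] r] [[c' e'] r'] /= -> h.
by congr (_, _, _); apply/ffunP => i; have [] := h i.
Qed.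

(** The ranks of the occurrences of a letter are distinct and smaller than their number, so they
    fill an initial segment; the block has equally many coordinates, so the rank of [i] is among
    them. *)
Lemma rank_onto (w : {ffun 'I_N -> I}) i : w \in words ->
  exists l, w l = be i /\ rank (fun a b => a < b) w l = rank (fun a b => b < a) be i.
Proof.
rewrite inE => /andP[_ /forallP /(_ (be i)) /eqP wc].
pose A := [set l | w l == be i].
pose rs := [seq rank (fun a b => a < b) w l | l <- enum A].
have rsu : uniq rs.
  rewrite map_inj_in_uniq ?enum_uniq // => l k.
  rewrite !mem_enum !inE => /eqP wl /eqP wk rlk.
  case: (ltngtP l k) => [lk|kl|/val_inj //].
    by have := rank_ltn_lt lk (etrans wl (esym wk)); rewrite rlk ltnn.
  by have := rank_ltn_lt kl (etrans wk (esym wl)); rewrite rlk ltnn.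
have rss : {subset rs <= iota 0 #|A|}.
  move=> x /mapP[l]; rewrite mem_enum inE => /eqP wl ->.
  rewrite mem_iota /= add0n; apply: proper_card; apply/fintype.properP; split.
    by apply/fintype.subsetP => k; rewrite !inE wl => /andP[].
  by exists l; rewrite !inE ?wl ?eqxx ?ltnn.
have [|_ E] := uniq_min_size rsu rss; first by rewrite size_map size_iota -cardE.
have : rank (fun a b => b < a) be i \in rs.
  rewrite E mem_iota /= add0n wc; apply: proper_card; apply/fintype.properP; split.
    by apply/fintype.subsetP => k; rewrite !inE => /andP[].
  by exists i; rewrite !inE ?eqxx ?ltnn.
by case/mapP => l; rewrite mem_enum inE => /eqP wl ->; exists l.
Qed.

Lemma word_onto w : w \in words -> exists2 f, good f & word f = w.
Proof.
move=> wW; have [r0 hr] := fin_all_exists (fun i => rank_onto i wW).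
have r0_inj : injective r0.
  move=> i k ik; apply: (@rank_gtn_inj be); first by rewrite -!(proj1 (hr _)) ik.
  by rewrite -!(proj2 (hr _)) ik.
pose r := perm r0_inj.
have ltn1 : n.-1 < n by rewrite prednK.
pose top : 'I_n := Ordinal ltn1.
pose bot : 'I_n := Ordinal n_gt0.
pose f : flag := ([ffun i => if par i then bot else top], [ffun i => ~~ par i], r).
have wf : word f = w.
  apply/ffunP => l; rewrite ffunE /=.
  by rewrite -(proj1 (hr _)) -(permE r0_inj) permKV.
exists f => //; apply/goodP; split.
- move=> i; rewrite /= permE -(proj1 (hr i)).
  by move: wW; rewrite inE => /andP[/forallP].
- move=> i k ik bik; rewrite /= !permE.
  have := rank_gtn_lt ik (esym bik); rewrite -!(proj2 (hr _)).
  case: (ltngtP (r0 k) (r0 i)) => // [h|/val_inj ->]; last by rewrite ltnn.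
  move/ltn_trans: (rank_ltn_lt h (etrans (etrans (proj1 (hr i)) bik) (esym (proj1 (hr k))))).
  by move=> /[apply]; rewrite ltnn.
- move=> i; rewrite /corner /= !ffunE; case: (par i) => //=.
  by rewrite addn1 prednK.
Qed.

Lemma card_good : #|good| = #|words|.
Proof.
rewrite -(card_in_imset word_inj); apply: eq_card => w.
apply/idP/idP => [/imsetP[f fg ->]|/word_onto[f fg <-]]; last exact: imset_f.
have /goodP[f0 fd _] : good f by [].
rewrite inE; apply/andP; split; apply/forallP; last move=> B.
  by move=> l; rewrite ffunE; have := f0 ((f.2^-1)%g l); rewrite permKV.
rewrite -[X in _ == X](card_imset _ (@perm_inj _ f.2)); apply/eqP/eq_card => l; rewrite inE ffunE.
apply/idP/imsetP => [h|[i]]; first by exists ((f.2^-1)%g l); rewrite ?inE ?permKV.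
by rewrite inE => h ->; rewrite permK.
Qed.

(* In cohomological terms, the parity of [words] is the coefficient of the
   fundamental class of a product of projective spaces in a product of N
   classes of degree one. *)
Theorem alternating_flag (s : nat -> gpoint -> bool) :
    (forall l, l < N -> equivariant (s l) (al l)) -> odd #|words| ->
  exists f : flag, forall l, l < N -> s l (vtx f l) != s l (vtx f l.+1).
Proof.
move=> s_eqv; rewrite -card_good -sgn_sum_sigs.
rewrite -(sgn_sum_eqv s_eqv); last by move=> l _; exact: sigs_eqv.
move=> S1; case: (pickP (fun f : flag =>
  \big[andb/true]_(l < N) (s l (vtx f l) (+) s l (vtx f l.+1)))) => [f|h].
  rewrite big_andE => /forallP hf; exists f => l lN.
  by have := hf (Ordinal lN); rewrite /=; case: (s _ _); case: (s _ _).
by move: S1; rewrite /sgn_sum big1.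
Qed.

End GoodFlags.

End Corners.

End Grid.

(** * The top class modulo 2 *)

Definition quad := (nat * nat * nat * nat)%type.

Definition qnth (x : quad) (i : nat) : nat :=
  let: (a, b, c, d) := x in
  match i with 0 => a | 1 => b | 2 => c | _ => d end.

Definition qincr (i : nat) (x : quad) : quad :=
  let: (a, b, c, d) := x in
  match i with
  | 0 => (a.+1, b, c, d) | 1 => (a, b.+1, c, d)
  | 2 => (a, b, c.+1, d) | _ => (a, b, c, d.+1)
  end.

Definition qmap (f : nat -> nat) (x : quad) : quad :=
  let: (a, b, c, d) := x in (f a, f b, f c, f d).

Definition qall (p : pred nat) (x : quad) : bool :=
  let: (a, b, c, d) := x in [&& p a, p b, p c & p d].

(* A polynomial p over F_2 in x_0, ..., x_3 is encoded by its coefficients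
   counted from a top degree D, [g y] being the coefficient of
   \prod_i x_i^(D - y_i).  Then [lmul A] is multiplication by the linear form
   \sum_(i in A) x_i. *)
Definition lmul (A : seq nat) (g : quad -> bool) (x : quad) : bool :=
  let t i := if i \in A then g (qincr i x) else false in
  t 0 (+) (t 1 (+) (t 2 (+) t 3)).

Fixpoint lprod (ss : seq (seq nat)) (g : quad -> bool) : quad -> bool :=
  if ss is A :: ss' then lmul A (lprod ss' g) else g.

Definition qtop (D : nat) (x : quad) : bool := x == (D, D, D, D).

Lemma lmulE A g x : lmul A g x =
  \big[addb/false]_(i <- iota 0 4) ((i \in A) && g (qincr i x)).
Proof. by rewrite /= !big_cons big_nil addbF. Qed.

Lemma qincrC i k (x : quad) : qincr i (qincr k x) = qincr k (qincr i x).
Proof. by case: x => [[[a b] c] d]; case: i => [|[|[|i]]]; case: k => [|[|[|k]]]. Qed.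

Lemma lmul2E A B g x : lmul A (lmul B g) x =
  \big[addb/false]_(i <- iota 0 4) \big[addb/false]_(k <- iota 0 4)
     ((i \in A) && (k \in B) && g (qincr k (qincr i x))).
Proof.
rewrite lmulE; apply: eq_bigr => i _.
rewrite lmulE big_distrr /=; apply: eq_bigr => k _.
by rewrite andbA.
Qed.

Lemma lmulC A B g x : lmul A (lmul B g) x = lmul B (lmul A g) x.
Proof.
rewrite !lmul2E exchange_big; apply: eq_bigr => i _; apply: eq_bigr => k _ /=.
by rewrite qincrC [(k \in _) && _]andbC.
Qed.

Lemma xor_symmetric (T : Type) (s : seq T) (h : T -> T -> bool) :
    (forall i k, h i k = h k i) ->
  \big[addb/false]_(i <- s) \big[addb/false]_(k <- s) h i k =
  \big[addb/false]_(i <- s) h i i.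
Proof.
move=> hC; elim: s => [|x s IH]; first by rewrite !big_nil.
rewrite !big_cons -IH; under [X in _ (+) X = _]eq_bigr => i _ do rewrite big_cons.
rewrite big_split /=.
have -> : \big[addb/false]_(i <- s) h i x = \big[addb/false]_(i <- s) h x i by exact: eq_bigr.
by rewrite -addbA addKb.
Qed.

Lemma eq_lmul A g g' : g =1 g' -> lmul A g =1 lmul A g'.
Proof. by move=> gg x; rewrite /lmul !gg. Qed.

Lemma eq_lprod ss g g' : g =1 g' -> lprod ss g =1 lprod ss g'.
Proof. by move=> gg; elim: ss => //= A ss IH; apply: eq_lmul. Qed.

Lemma lprod_cat s1 s2 g : lprod (s1 ++ s2) g = lprod s1 (lprod s2 g).
Proof. by elim: s1 => //= A s1 ->. Qed.

Lemma lprod_mid A s1 s2 g : lprod (s1 ++ A :: s2) g =1 lprod (A :: s1 ++ s2) g.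
Proof.
elim: s1 => //= B s1 IH x.
by rewrite (eq_lmul B IH) lmulC.
Qed.

Lemma perm_lprod s1 s2 g : perm_eq s1 s2 -> lprod s1 g =1 lprod s2 g.
Proof.
elim: s1 s2 => [|A s1 IH] s2; first by move/perm_size; case: s2.
move=> h x; have As2 : A \in s2 by rewrite -(perm_mem h) mem_head.
case/splitPr: As2 h => p1 p2; rewrite perm_sym perm_catC /= perm_cons perm_sym => h.
rewrite lprod_mid /=; apply: eq_lmul => y; apply: IH.
by rewrite perm_sym perm_catC perm_sym.
Qed.

(** The substitution of [x_i ^ 2] for [x_i], the top degree being doubled as well, so that exponents
    counted from the top also double. *)
Definition qdil (g : quad -> bool) (x : quad) : bool :=
  qall (fun a => ~~ odd a) x && g (qmap half x).

Definition twice (T : Type) (s : seq T) := flatten [seq [:: A; A] | A <- s].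

(** Over F_2 the square of a linear form is the sum of the squares of its variables: the cross terms
    are symmetric in the two indices and cancel. *)
Lemma lmul_qdil A g : lmul A (lmul A (qdil g)) =1 qdil (lmul A g).
Proof.
move=> x; rewrite lmul2E xor_symmetric; last first.
  by move=> i k; rewrite qincrC [(k \in _) && _]andbC.
rewrite /qdil lmulE big_distrr /=; apply: eq_bigr => i _.
rewrite andbb; case: (i \in A); rewrite ?andbF //=.
by case: x => [[[a b] c] d]; case: i => [|[|[|i]]]; rewrite /= !negbK.
Qed.

Lemma lprod_twice ss g : lprod (twice ss) (qdil g) =1 qdil (lprod ss g).
Proof.
elim: ss => //= A ss IH x; rewrite -lmul_qdil.
by apply: eq_lmul; apply: eq_lmul.
Qed.

Lemma lprod_shift ss g g' r : (forall x, g (qmap (addn r) x) = g' x) ->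
  forall x, lprod ss g (qmap (addn r) x) = lprod ss g' x.
Proof.
move=> gg; elim: ss => //= A ss IH x.
rewrite !lmulE; apply: eq_bigr => i _; rewrite -IH; congr (_ && lprod _ _ _).
by case: x => [[[a b] c] d]; case: i => [|[|[|i]]]; rewrite /= addnS.
Qed.

Lemma qtop_shift r D x : qtop (r + D) (qmap (addn r) x) = qtop D x.
Proof.
by case: x => [[[a b] c] d]; rewrite /qtop !xpair_eqE /= !eqn_add2l.
Qed.

Lemma qdil_qtop D x : qtop D.*2 x = qdil (qtop D) x.
Proof. case: x => [[[a b] c] d]; rewrite /qdil /qtop /= !xpair_eqE; lia. Qed.

Definition qadd (x y : quad) : quad :=
  let: (a, b, c, d) := x in let: (a', b', c', d') := y in
  (a + a', b + b', c + c', d + d').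

(** Addition over F_2 of a monomial to a polynomial stored as the list of its monomials: a second
    copy cancels the first. *)
Definition toggle (x : quad) (s : seq quad) := if x \in s then rem x s else x :: s.

Definition mul_form (A : seq nat) (K : seq quad) : seq quad :=
  foldr toggle [::] [seq qincr i b | i <- [seq i <- iota 0 4 | i \in A], b <- K].

Definition expand (ss : seq (seq nat)) : seq quad :=
  foldr mul_form [:: (0, 0, 0, 0)] ss.

Lemma xor_toggle (f : quad -> bool) (s : seq quad) :
  \big[addb/false]_(b <- foldr toggle [::] s) f b = \big[addb/false]_(b <- s) f b.
Proof.
elim: s => //= x s IH; rewrite big_cons -IH /toggle.
case: ifP => [xs|_]; last by rewrite big_cons.
by rewrite [in RHS](perm_big _ (perm_to_rem xs)) big_cons addKb.
Qed.

Lemma lprod_expand ss g x : lprod ss g x = \big[addb/false]_(b <- expand ss) g (qadd x b).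
Proof.
elim: ss x => [|A ss IH] x /=.
  by rewrite big_cons big_nil addbF; case: x => [[[a b] c] d]; rewrite /= !addn0.
rewrite xor_toggle big_allpairs_dep big_filter lmulE big_mkcond /=; apply: eq_bigr => i _.
case: (i \in A) => //=; rewrite IH; apply: eq_bigr => k _; congr (g _).
case: x k => [[[a b] c] d] [[[a' b'] c'] d'].
by case: i => [|[|[|i]]]; rewrite /= addSnnS.
Qed.

Lemma lprod_leaves ss (p : pred quad) g g' x : all (fun b => p (qadd x b)) (expand ss) ->
  (forall y, p y -> g y = g' y) -> lprod ss g x = lprod ss g' x.
Proof.
move=> /allP pss gg; rewrite !lprod_expand big_seq [RHS]big_seq.
by apply: eq_bigr => b /pss /gg.
Qed.

(* The hyperplane indices carried by the equations.  The tests of a mass that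
   is equipartitioned by any three of H_0, ..., H_3 are [triple_forms ++
   pair_forms], those of a mass equipartitioned by any two of H_1, H_2, H_3
   are [pair_forms]. *)
Definition pair_forms : seq (seq nat) :=
  [:: [:: 1]; [:: 2]; [:: 3]; [:: 1; 2]; [:: 1; 3]; [:: 2; 3]].
Definition triple_forms : seq (seq nat) :=
  [:: [:: 0]; [:: 0; 1]; [:: 0; 2]; [:: 0; 3];
      [:: 0; 1; 2]; [:: 0; 1; 3]; [:: 0; 2; 3]; [:: 1; 2; 3]].

(** The window of exponents, counted down from the top degree [D], that is followed through the
    induction. Their total is 6 because [4 * D - 6] forms are multiplied; the bound 4 is chosen so
    that the window is stable under the halving step. *)
Definition in_box (x : quad) : bool :=
  let: (a, b, c, d) := x in
  [&& a <= 4, b <= 4, c <= 4, d <= 4 & a + b + c + d == 6].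

Definition box_seq : seq quad :=
  let t := iota 0 5 in
  [seq x <- [seq (abc, d) | abc <- [seq (ab, c) | ab <- [seq (a, b) | a <- t, b <- t],
     c <- t], d <- t] | in_box x].

(** The two patterns of coefficients that occur in the window. Both are odd at (0, 1, 2, 3), the
    monomial sought. *)
Definition table (rho : bool) (x : quad) : bool :=
  let: (a, b, c, d) := x in
  (rho ==> (a == 0)) && perm_eq [:: a; b; c; d] (iota 0 4).

Definition halved (r : bool) : quad -> quad := qmap (fun a => a./2 - r).

Definition even_leaf (r : bool) (x : quad) : bool :=
  qall (fun a => ~~ odd a) x ==> qall (fun a => r <= a./2) x && in_box (halved r x).

Definition dil_table (r rho : bool) (x : quad) : bool :=
  qall (fun a => ~~ odd a) x && table rho (halved r x).

Definition step_forms (r : bool) := (if r then triple_forms else [::]) ++ pair_forms.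

Definition step_ok (r rho rho' : bool) : bool :=
  let K := expand (step_forms r) in
  all (fun x => let xK := [seq qadd x b | b <- K] in
    all (even_leaf r) xK &&
    (foldr addb false [seq dil_table r rho y | y <- xK] == table rho' x)) box_seq.

(** Only even leaves survive the dilation; their halves, lowered by [r], must stay in the window,
    and the tables must match. This concerns finitely many exponents and is decided by
    evaluation. *)
Lemma table_step_ok r rho : step_ok r rho (rho || ~~ r).
Proof. by case: r; case: rho; vm_compute. Qed.

Definition base_ok : bool :=
  let K := expand (triple_forms ++ pair_forms) in
  all (fun x => foldr addb false [seq qtop 5 (qadd x b) | b <- K] == table false x) box_seq.

Lemma table_base_ok : base_ok.
Proof. by vm_compute. Qed.

Lemma foldr_addb (T : Type) (f : T -> bool) (s : seq T) :
  foldr addb false [seq f y | y <- s] = \big[addb/false]_(y <- s) f y.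
Proof. by rewrite foldrE big_map. Qed.

Lemma mem_box_seq x : in_box x -> x \in box_seq.
Proof.
case: x => [[[a b] c] d] hx; rewrite mem_filter hx andTb; move: hx => /and5P[ha hb hc hd _].
have hm k : k <= 4 -> k \in iota 0 5 by rewrite mem_iota.
apply/allpairsP; exists (a, b, c, d); split; [|exact: hm|by []].
apply/allpairsP; exists (a, b, c); split; [|exact: hm|by []].
by apply/allpairsP; exists (a, b); split; rewrite /= ?hm.
Qed.

Lemma table_base x : in_box x ->
  lprod (triple_forms ++ pair_forms) (qtop 5) x = table false x.
Proof.
move=> /mem_box_seq; move/allP: table_base_ok => /[apply] /eqP <-.
by rewrite lprod_expand foldr_addb.
Qed.

Lemma table_step r rho x : in_box x ->
  (forall b, b \in expand (step_forms r) -> even_leaf r (qadd x b)) /\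
  lprod (step_forms r) (dil_table r rho) x = table (rho || ~~ r) x.
Proof.
move=> /mem_box_seq; move/allP: (table_step_ok r rho) => /[apply] /andP[].
move=> /allP h /eqP <-; split => [b bK|]; first by apply/h/map_f.
by rewrite lprod_expand foldr_addb big_map.
Qed.

Definition forms (m s : nat) : seq (seq nat) :=
  flatten (nseq m triple_forms) ++ flatten (nseq s pair_forms).

Lemma perm_forms_step (r : bool) m s :
  perm_eq (forms (m.*2 + r) s.*2.+1) (step_forms r ++ twice (forms m s)).
Proof.
have cd T (a : pred T) (u : seq T) : count a (twice u) = (count a u).*2.
  by elim: u => //= A u IH; rewrite IH; lia.
have cn T (a : pred T) k (u : seq T) : count a (flatten (nseq k u)) = k * count a u.
  by elim: k => //= k IH; rewrite count_cat IH mulSn.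
apply/seq.permP => a; rewrite /step_forms /forms count_cat !cn !count_cat cd count_cat !cn.
have -> : count a (if r then triple_forms else [::]) = r * count a triple_forms.
  by case: r; rewrite ?mul1n.
move: (count a triple_forms) (count a pair_forms) => u v; case: r => /=; nia.
Qed.

(* Squaring is the Frobenius, so E^(2m+r) F^(2s+1) is E^r F times the dilation
   of E^m F^s, and halving t reduces q by one. *)
Lemma table_forms q t : 1 <= t <= 2 ^ q -> exists rho, forall x, in_box x ->
  lprod (forms (2 ^ q.+1 - t) (2 ^ q.+1 - 1)) (qtop (7 * 2 ^ q - 2 * t)) x = table rho x.
Proof.
elim: q t => [|q IH] t ht.
  have -> : t = 1 by lia.
  by exists false => x hx; rewrite -table_base // /forms /= !cats0.
(* For odd [t] the exponent of E is odd, so one factor E is left outside the square; [t'] is [t / 2]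
   rounded up. *)
pose r := odd t; pose t' := t./2 + r.
have tE : t = t'.*2 - r by rewrite /t' /r; lia.
have q2 : 2 ^ q.+1 = (2 ^ q).*2 by rewrite expnS mul2n.
have q3 : 2 ^ q.+2 = (2 ^ q.+1).*2 by rewrite expnS mul2n.
have ht' : 1 <= t' <= 2 ^ q by rewrite /t' /r; lia.
have [rho hrho] := IH t' ht'; exists (rho || ~~ r) => x hx.
have [hl <-] := table_step r rho hx.
have -> : 2 ^ q.+2 - t = (2 ^ q.+1 - t').*2 + r by rewrite q3 q2 {1}tE; lia.
have -> : 2 ^ q.+2 - 1 = (2 ^ q.+1 - 1).*2.+1 by rewrite q3 q2; lia.
have -> : 7 * 2 ^ q.+1 - 2 * t = (r + (7 * 2 ^ q - 2 * t')).*2 by rewrite q2 {1}tE; lia.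
rewrite (perm_lprod _ (perm_forms_step _ _ _)) lprod_cat.
apply: (@lprod_leaves _ (even_leaf r)) => [|y hy]; first exact/allP.
rewrite (eq_lprod _ (qdil_qtop _)) lprod_twice /qdil /dil_table.
move: hy; rewrite /even_leaf; case: (qall _ y) => //= /andP[hr hb].
rewrite -(hrho _ hb) -[RHS](lprod_shift _ (@qtop_shift r _)).
congr (lprod _ _ _); move: hr; rewrite /halved.
by case: y {hb} => [[[a b] c] d] /= /and4P[*]; rewrite !subnKC.
Qed.

(** * Words as coefficients of products of linear forms *)

Definition fcons (T : finType) N (p : T * {ffun 'I_N -> T}) : {ffun 'I_N.+1 -> T} :=
  [ffun i => if unlift ord0 i is Some k then p.2 k else p.1].

Lemma xor_fcons (T : finType) N (F : {ffun 'I_N.+1 -> T} -> bool) :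
  \big[addb/false]_w F w = \big[addb/false]_(B : T) \big[addb/false]_w F (fcons (B, w)).
Proof.
rewrite pair_bigA /= (reindex (@fcons T N)) /=; first by apply: eq_bigr => -[B w] _.
pose g (w : {ffun 'I_N.+1 -> T}) := (w ord0, [ffun k => w (lift ord0 k)]).
exists g => [[B w] _|w _].
  congr (_, _); first by rewrite ffunE unlift_none.
  by apply/ffunP => k; rewrite !ffunE liftK.
by apply/ffunP => i; rewrite !ffunE; case: unliftP => [k ->|->]; rewrite ?ffunE.
Qed.

Definition nletters (T : finType) N (w : {ffun 'I_N -> T}) (B : T) := #|[set l | w l == B]|.

Lemma nletters_fcons (T : finType) N (B C : T) (w : {ffun 'I_N -> T}) :
  nletters (fcons (B, w)) C = (B == C) + nletters w C.
Proof.
rewrite /nletters -!sum1dep_card big_mkcond big_ord_recl /= !ffunE unlift_none /=.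
congr (_ + _).
by rewrite [RHS]big_mkcond; apply: eq_bigr => i _; rewrite ffunE liftK.
Qed.

Lemma qnth_qincr x (B C : 'I_4) : qnth (qincr B x) C = (B == C) + qnth x C.
Proof.
by case: x => [[[a b] c] d]; case: B => [[|[|[|[|?]]]] ?] //;
  case: C => [[|[|[|[|?]]]] ?].
Qed.

(** Choosing the first letter of a word amounts to choosing a variable in the first factor when the
    product is expanded. *)
Lemma words_lprod N (ss : seq (seq nat)) (D : nat) x : size ss = N ->
  \big[addb/false]_(w : {ffun 'I_N -> 'I_4})
     ([forall l : 'I_N, (w l : nat) \in nth [::] ss l] &&
      [forall B : 'I_4, qnth x B + nletters w B == D]) = lprod ss (qtop D) x.
Proof.
elim: N ss x => [|N IH] ss x.
  pose w0 : {ffun 'I_0 -> 'I_4} := [ffun=> ord0].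
  move/size0nil->; rewrite (bigD1 w0) //= big1 ?addbF; last first.
    by move=> w /eqP[]; apply/ffunP => -[].
  have -> : [forall l : 'I_0, (w0 l : nat) \in nth [::] [::] l].
    by apply/forallP => -[].
  have nl B : nletters w0 B = 0.
    by apply/eqP; rewrite cards_eq0; apply/eqP/setP => -[].
  case: x => [[[a b] c] d]; rewrite /qtop !xpair_eqE; apply/forallP/idP => [h|].
    have := h (@Ordinal 4 0 isT); have := h (@Ordinal 4 1 isT).
    have := h (@Ordinal 4 2 isT); have := h (@Ordinal 4 3 isT).
    by rewrite !nl /= !addn0 => -> -> -> ->.
  move=> /andP[/andP[/andP[ha hb] hc] hd] [[|[|[|[|?]]]] ?] //=; by rewrite nl addn0.
case: ss => // A ss [sN]; rewrite xor_fcons /= lmulE.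
rewrite -[iota 0 4]/(index_iota 0 4) big_mkord; apply: eq_bigr => B _.
rewrite -IH // big_distrr /=; apply: eq_bigr => w _; rewrite andbA.
congr (_ && _).
  apply/forallP/andP => [h|[hA /forallP h] l].
    split; first by have := h ord0; rewrite !ffunE unlift_none.
    by apply/forallP => l; have := h (lift ord0 l); rewrite ffunE liftK.
  by rewrite ffunE; case: unliftP => [k ->|->] //=; apply: h.
apply: eq_forallb => C.
by rewrite nletters_fcons qnth_qincr addnCA addnA.
Qed.

Lemma odd_words N (be : 'I_N -> 'I_4) (ss : seq (seq nat)) (D : nat) x : size ss = N ->
    (forall B : 'I_4, qnth x B + #|[set i | be i == B]| = D) ->
  odd #|words be (fun l => [set B : 'I_4 | (B : nat) \in nth [::] ss l])| =
  lprod ss (qtop D) x.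
Proof.
move=> sN hD; rewrite -(words_lprod D x sN) -xor_card; apply: eq_bigr => w _.
rewrite -[LHS]/(w \in words be _) inE; congr (_ && _); apply: eq_forallb => l; first by rewrite inE.
by rewrite -(hD l) eqn_add2l.
Qed.

(** * Borsuk-Ulam for products of cubes *)

Import numFieldNormedType.Exports.
Local Open Scope classical_set_scope.
Local Open Scope ring_scope.

Section BorsukUlam.

Variables (R : realType) (I : finType) (N : nat) (be : 'I_N -> I).

Lemma increasing_seq_cvg (f : nat -> nat) : increasing_seq f -> f n @[n --> \oo] --> \oo.
Proof.
move=> fi; have h n : (n <= f n)%N.
  elim: n => // n IH; apply: (leq_ltn_trans IH).
  by have := fi n.+1 n; rewrite leEnat ltnn ltnNge => ->.
move=> A [M _ MA]; exists M => // n /= Mn; apply: MA => /=.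
exact: leq_trans (h n).
Qed.

Lemma bounded_subseq (u : nat -> 'I_N -> R) (M : R) : (forall n i, `|u n i| <= M) ->
  exists (f : nat -> nat) (y : 'I_N -> R),
    f n @[n --> \oo] --> \oo /\ forall i, u (f n) i @[n --> \oo] --> y i.
Proof.
move=> uM; suff h k : exists f : nat -> nat, increasing_seq f /\
    forall i : 'I_N, (i < k)%N -> cvgn (fun n => u (f n) i).
  have [f [fi fc]] := h N; exists f, (fun i => limn (fun n => u (f n) i)).
  by split => [|i]; [exact: increasing_seq_cvg | exact: (fc i (ltn_ord i))].
elim: k => [|k [f [fi fc]]]; first by exists id.
have [kN|Nk] := ltnP k N; last first.
  by exists f; split => // i _; apply: fc; exact: leq_trans Nk.
have [|g gi gc] := @bolzano_weierstrass R (fun n => u (f n) (Ordinal kN)).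
  by exists M; split => [|x Mx n _ /=]; [exact: num_real | apply: le_trans (ltW Mx)].
exists (f \o g); split => [n m /=|i]; first by rewrite fi; exact: gi.
rewrite ltnS leq_eqVlt => /predU1P[ik|ik].
  by rewrite (_ : i = Ordinal kN) //; apply: val_inj.
have /cvg_ex[l hl] := fc i ik; apply/cvg_ex; exists l.
exact: (cvg_comp _ _ (increasing_seq_cvg gi) hl).
Qed.

Definition flip (B : I) (y : 'I_N -> R) (i : 'I_N) := if be i == B then - y i else y i.

Variables (al : nat -> {set I}) (F : nat -> ('I_N -> R) -> R).

Hypothesis F_cont : forall l, (l < N)%N -> forall (u : nat -> 'I_N -> R) (y : 'I_N -> R),
  (forall i, u n i @[n --> \oo] --> y i) -> F l (u n) @[n --> \oo] --> F l y.

Hypothesis F_flip : forall l, (l < N)%N -> forall y i, `|y i| = 1 ->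
  F l (flip (be i) y) = if be i \in al l then - F l y else F l y.

Definition gpos (n : nat) (x : gpoint N) (i : 'I_N) : R := (x i)%:R / n%:R - 1.

Lemma gpos_tau n B (x : gpoint N) : (0 < n)%N -> (forall i, (x i <= n.*2)%N) ->
  gpos n (tau n be B x) = flip B (gpos n x).
Proof.
move=> n0 xn; apply/funext => i; rewrite /gpos /flip ffunE.
case: ifP => // _; rewrite natrB // -muln2 natrM mulrBl mulrAC divff ?mul1r; first lra.
by rewrite pnatr_eq0 -lt0n.
Qed.

Lemma gpos_bd n (x : gpoint N) i : (0 < n)%N -> bd n (x i) -> `|gpos n x i| = 1.
Proof.
move=> n0; rewrite /bd /gpos => /orP[] /eqP ->.
  by rewrite mul0r sub0r normrN1.
by rewrite -muln2 natrM mulrAC divff ?pnatr_eq0 -?lt0n // mul1r (_ : 2%:R - 1 = 1) ?normr1 //; lra.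
Qed.

(** The sign of [F l]. A zero of [F l] has no sign for the antipodal map to reverse, so there the
    equivariant label [sigs] decides. *)
Definition grid_label n l (x : gpoint N) : bool :=
  if F l (gpos n x) == 0 then sigs n be (al l) x else 0 < F l (gpos n x).

Lemma grid_label_eqv n l : (0 < n)%N -> (l < N)%N ->
  equivariant n be (grid_label n l) (al l).
Proof.
move=> n0 lN B x xn hx; rewrite /grid_label gpos_tau //.
have /existsP[i /andP[/eqP iB xi]] := hx; rewrite -iB in hx *.
rewrite F_flip ?gpos_bd //; case ial: (be i \in al l).
  rewrite oppr_eq0; case: eqP => [_|/eqP F0]; first by rewrite sigs_eqv // ial.
  by rewrite oppr_gt0 addbT -leNgt lt_neqAle F0.
by case: eqP => [_|F0]; rewrite ?sigs_eqv // ?ial ?addbF.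
Qed.

Lemma label_neq_le0 n l (x x' : gpoint N) : grid_label n l x != grid_label n l x' ->
  F l (gpos n x) * F l (gpos n x') <= 0.
Proof.
rewrite /grid_label; case: (F l (gpos n x) =P 0) => [->|/eqP F0]; first by rewrite mul0r.
case: (F l (gpos n x') =P 0) => [->|/eqP F0']; first by rewrite mulr0.
case: ltrP => h; case: ltrP => h' // _; first by rewrite mulr_ge0_le0 // ltW.
by rewrite mulr_le0_ge0 // ltW.
Qed.

Lemma gpos_vtx n (f : flag N n) m i : (0 < n)%N ->
  `|gpos n (vtx f m) i - gpos n (vtx f 0) i| <= n%:R^-1.
Proof.
move=> n0; rewrite /gpos opprB addrA subrK -mulrBl normrM [`|_^-1|]ger0_norm ?invr_ge0 //.
rewrite -[leRHS]mul1r; apply: ler_wpM2r; rewrite ?invr_ge0 //.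
rewrite !ffunE ltn0; case: ifP => _; last by rewrite subrr normr0.
rewrite doubleD -addn1 !natrD opprD addrACA subrr add0r.
by rewrite -muln2 natrM ler_norml; case: (f.1.2 i) => /=; lra.
Qed.

Lemma gpos_vtx_le1 n (f : flag N n) m i : (0 < n)%N -> `|gpos n (vtx f m) i| <= 1.
Proof.
move=> n0; have := vtx_le f m i; rewrite /gpos -muln2 -(ler_nat R) natrM => h.
have n0' : (0 : R) < n%:R by rewrite ltr0n.
rewrite ler_norml; apply/andP; split.
  by rewrite lerBrDl subrr divr_ge0.
by rewrite lerBlDr ler_pdivrMr // mulrC.
Qed.

(** Alternating flags of ever finer grids accumulate at a point [y] to which all their vertices
    converge. The values of [F l] at the vertices [l] and [l + 1] have a product at most 0, hence in
    the limit so has the square of [F l y]. *)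
Theorem borsuk_ulam : odd #|words be al| ->
  exists y : 'I_N -> R, forall l, (l < N)%N -> F l y = 0.
Proof.
move=> hodd.
have h n := @alternating_flag I N n.+1 be (ltn0Sn n) al (grid_label n.+1)
  (fun l => @grid_label_eqv n.+1 l (ltn0Sn n)) hodd.
pose f n := projT1 (cid (h n)); have hf n := projT2 (cid (h n)).
pose v m n := gpos n.+1 (vtx (f n) m).
have [|phi [y [phioo v0y]]] := @bounded_subseq (v 0%N) 1.
  by move=> n i; exact: gpos_vtx_le1.
have vy m i : v m (phi n) i @[n --> \oo] --> y i.
  rewrite -[y i]addr0.
  have -> : (fun n => v m (phi n) i) =
      (fun n => v 0%N (phi n) i + (v m (phi n) i - v 0%N (phi n) i)).
    by apply/funext => n; rewrite addrC subrK.
  apply: cvgD; first exact: v0y.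
  apply: (cvg_comp _ _ phioo (_ : (fun n => v m n i - v 0%N n i) @ \oo --> 0)).
  apply/norm_cvg0P/(@squeeze_cvgr _ _ _ _ (cst 0) (@harmonic R)); last 2 first.
  - exact: cvg_cst.
  - exact: cvg_harmonic.
  by apply: nearW => n; rewrite normr_ge0 /=; exact: gpos_vtx.
exists y => l lN.
have c m : F l (v m (phi n)) @[n --> \oo] --> F l y by apply: F_cont => // i; exact: vy.
have : F l y * F l y <= 0.
  have cc : (fun n => F l (v l (phi n)) * F l (v l.+1 (phi n))) @ \oo -->
    F l y * F l y by apply: cvgM; exact: c.
  rewrite -(cvg_lim (@norm_hausdorff _ _) cc).
  apply: limr_le; first exact: (cvgP _ cc).
  by apply: nearW => n; apply: label_neq_le0; exact: hf.
by rewrite -expr2 => F2; apply/eqP; rewrite -sqrf_eq0 eq_le F2 sqr_ge0.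
Qed.

End BorsukUlam.

(** * Hyperplanes are null sets *)

Section NullHyperplane.

Variables (R : realType) (d : nat).

Lemma sum_nth_le (s : seq R) N : (forall x, x \in s -> 0 <= x) ->
  \sum_(n < N) nth 0 s n <= \sum_(x <- s) x.
Proof.
elim: N s => [|N IH] [|x s] s0.
- by rewrite big_ord0 big_nil.
- by rewrite big_ord0 big_seq sumr_ge0.
- by rewrite big_nil big1 // => i _; rewrite nth_nil.
- rewrite big_ord_recl big_cons /= lerD2l; apply: IH => y ys.
  by rewrite s0 // in_cons ys orbT.
Qed.

(** The finite cover is continued by boxes reduced to the origin; [0 < d] makes their volume zero
    rather than an empty product. *)
Lemma lebesgue_null_fin_cover (A : set (d.-tuple R)) : (0 < d)%N ->
  (forall eps : R, 0 < eps -> exists (C : finType) (lo hi : C -> 'I_d -> R),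
    [/\ forall c i, lo c i <= hi c i, A `<=` \bigcup_c box (lo c) (hi c)
      & \sum_c box_vol (lo c) (hi c) <= eps]) -> lebesgue_null A.
Proof.
move=> d0 h eps e0; have [C [lo [hi [lohi Ac Vc]]]] := h eps e0.
pose s := [seq (lo c, hi c) | c <- enum C].
pose z : 'I_d -> R := fun=> 0.
exists (fun n => (nth (z, z) s n).1), (fun n => (nth (z, z) s n).2); split.
- move=> n i; have [ns|sn] := ltnP n (size s); last by rewrite nth_default.
  have /mapP[c _ ->] : nth (z, z) s n \in s by exact: mem_nth.
  exact: lohi.
- move=> u /Ac[c _ uc]; exists (index c (enum C)) => //.
  have ci : (index c (enum C) < size (enum C))%N by rewrite index_mem mem_enum.
  by rewrite /s (nth_map c) // nth_index ?mem_enum.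
- move=> N; apply: le_trans Vc.
  pose sv := [seq box_vol (lo c) (hi c) | c <- enum C].
  rewrite (_ : \sum_c box_vol (lo c) (hi c) = \sum_(x <- sv) x); last by rewrite big_map big_enum.
  apply: le_trans (_ : \sum_(n < N) nth 0 sv n <= _); last first.
    apply: sum_nth_le => x /mapP[c _ ->]; apply: prodr_ge0 => i _.
    by rewrite subr_ge0.
  apply: ler_sum => n _; have [ns|sn] := ltnP n (size (enum C)).
    have ns' := ns; rewrite -cardE in ns'; have c := enum_val (Ordinal ns').
    by rewrite (nth_map c) // [sv`_n](nth_map c).
  rewrite nth_default; last by rewrite size_map.
  rewrite nth_default /box_vol; last by rewrite size_map.
  by rewrite (bigD1 (Ordinal d0)) //= subrr mul0r.
Qed.

Lemma grid_index (M L : nat) (v K : R) : (0 < M)%N -> 0 <= v <= K -> K * M%:R < L%:R ->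
  exists c : 'I_L, c%:R / M%:R <= v <= c%:R / M%:R + M%:R^-1.
Proof.
move=> M0 /andP[v0 vK] KL; have M0' : (0 : R) < M%:R by rewrite ltr0n.
have /truncn_itv/andP[h1 h2] : 0 <= v * M%:R by rewrite mulr_ge0.
have cL : (Num.truncn (v * M%:R) < L)%N.
  rewrite -(ltr_nat R) (le_lt_trans h1) // (le_lt_trans _ KL) //.
  by rewrite ler_wpM2r.
exists (Ordinal cL); rewrite /= ler_pdivrMr // h1 /=.
by rewrite -[X in _ + X]mul1r -mulrDl ler_pdivlMr // natr1 ltW.
Qed.

(* A hyperplane with nonzero j-th coefficient is the graph of a Lipschitz
   function of the other coordinates: over a cubical cell of side 1/M of these
   it lies in a box of height 2C/M. *)
Lemma null_bounded_hyperplane (H : hyperplane R d) (K : nat) : hp_nondeg H ->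
  lebesgue_null [set u | dotp u H.1 = H.2 /\ forall i, `|tnth u i| <= K%:R].
Proof.
case: H => a b [j /= aj0]; apply: lebesgue_null_fin_cover => [|eps e0].
  exact: leq_ltn_trans (ltn_ord j).
pose C : R := \sum_(i < d) `|tnth a i / tnth a j|.
have C0 : 0 <= C by apply: sumr_ge0 => i _.
(* The boxes have total volume [Q / M]: there are [L ^ d.-1] of them, each with [d.-1] sides of
   length [1 / M] and height [2 * C / M]. *)
pose Q : R := (2 * K).+1%:R ^+ d.-1 * (C * 2).
have Q0 : 0 <= Q by rewrite mulr_ge0 ?exprn_ge0 ?mulr_ge0.
pose M := (Num.truncn (Q / eps)).+1.
have M0 : (0 : R) < M%:R by rewrite ltr0n.
have MQ : Q / M%:R <= eps.
  rewrite ler_pdivrMr // mulrC -ler_pdivrMr // ltW //.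
  by have /truncn_itv/andP[] : 0 <= Q / eps by rewrite divr_ge0 // ltW.
(* The cells cover the interval from [- K] to [K + 1]; the extra unit provides an index for the
   endpoint [K]. *)
pose L := ((2 * K).+1 * M)%N.
pose J := {i : 'I_d | i != j}.
pose x (c : {ffun J -> 'I_L}) (i : 'I_d) : R :=
  if insub i is Some k then (c k)%:R / M%:R - K%:R else 0.
pose m c := (b - \sum_(i < d | i != j) x c i * tnth a i) / tnth a j.
pose lo c i := if i == j then m c - C / M%:R else x c i.
pose hi c i := if i == j then m c + C / M%:R else x c i + M%:R^-1.
exists {ffun J -> 'I_L}, lo, hi; split.
- move=> c i; rewrite /lo /hi; case: ifP => _; last by rewrite lerDl invr_ge0 ltW.
  by rewrite lerD2l ge0_cp // divr_ge0 // ltW.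
- move=> u [/= uH uK].
  have hc (k : J) : exists c : 'I_L, c%:R / M%:R <= tnth u (val k) + K%:R <= c%:R / M%:R + M%:R^-1.
    apply: (@grid_index _ _ _ (2 * K)%:R) => //.
      have := uK (val k); rewrite ler_norml natrM; lra.
    by rewrite -natrM ltr_nat ltn_mul2r ltnSn.
  have [c hcc] := fin_all_exists hc; exists (finfun c) => //.
  have xu i : i != j -> x (finfun c) i <= tnth u i <= x (finfun c) i + M%:R^-1.
    move=> ij; rewrite /x (insubT (fun i => i != j) ij) ffunE.
    have := hcc (Sub i ij); rewrite SubK; lra.
  move=> i; rewrite /lo /hi; case: (altP (i =P j)) => [->|ij]; last exact: xu.
  suff : `|tnth u j - m (finfun c)| <= C / M%:R by rewrite ler_norml; lra.
  rewrite /m; have -> : tnth u j = (b - \sum_(i < d | i != j) tnth u i * tnth a i) / tnth a j.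
    by rewrite -uH /dotp (bigD1 j) //= addrK mulfK.
  rewrite -mulrBl [X in X / _]addrC opprB addrA subrK -sumrB mulr_suml.
  apply: le_trans (ler_norm_sum _ _ _) _.
  rewrite /C mulr_suml [leRHS](bigD1 j) //= -[leLHS]add0r lerD ?mulr_ge0 ?invr_ge0 ?(ltW M0) //.
  apply: ler_sum => k kj; rewrite -mulrBl -mulrA normrM mulrC ler_wpM2l //.
  by have := xu k kj; rewrite ler_norml; lra.
have V c : box_vol (lo c) (hi c) = M%:R^-1 ^+ d.-1 * (C / M%:R * 2).
  rewrite /box_vol (bigD1 j) //= /lo /hi eqxx.
  rewrite (eq_bigr (fun=> M%:R^-1)) => [|i /negbTE ->]; last by rewrite addrAC subrr add0r.
  rewrite prodr_const cardC1 card_ord mulrC; congr (_ * _); lra.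
under eq_bigr do rewrite V.
rewrite sumr_const card_ffun card_ord card_sig cardC1 card_ord.
rewrite -[leLHS]mulr_natl natrX /L natrM mulrA -exprMn mulfK ?gt_eqF //.
by apply: le_trans MQ; rewrite /Q; lra.
Qed.

Lemma measurable_dotp (a : d.-tuple R) : measurable_fun setT (fun u => dotp u a).
Proof.
apply: measurable_sum => i; apply: measurable_funM; last exact: measurable_cst.
exact: measurable_tnth.
Qed.

Lemma hyperplane_null (mu : {finite_measure set (d.-tuple R) -> \bar R})
    (H : hyperplane R d) : abs_continuous mu -> hp_nondeg H ->
  mu.-negligible [set u | dotp u H.1 = H.2].
Proof.
move=> hmu Hn.
have -> : [set u | dotp u H.1 = H.2] =
    \bigcup_K [set u | dotp u H.1 = H.2 /\ forall i, `|tnth u i| <= K%:R].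
  apply/seteqP; split => [u /= uH|u [K _ []]//].
  exists (Num.truncn (\sum_i `|tnth u i|)).+1 => //; split => // i.
  have /truncn_itv/andP[_ /ltW] : 0 <= \sum_i `|tnth u i| by apply: sumr_ge0.
  by apply: le_trans; rewrite (bigD1 i) //= lerDl sumr_ge0.
apply: negligible_bigcup => K.
have mH : measurable [set u | dotp u H.1 = H.2 /\ forall i, `|tnth u i| <= K%:R].
  have -> : [set u | dotp u H.1 = H.2 /\ forall i, `|tnth u i| <= K%:R] =
     ((fun u : d.-tuple R => dotp u H.1) @^-1` [set H.2]) `&`
     \big[setI/setT]_(i < d) ((fun u : d.-tuple R => tnth u i) @^-1` `[- K%:R, K%:R]).
    rewrite -bigcap_seq.
    apply/seteqP; split => u /= [h1 h2]; split => // i.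
      by move=> _ /=; rewrite in_itv /= -ler_norml.
    by have := h2 i (mem_index_enum i); rewrite /= in_itv /= -ler_norml.
  apply: measurableI.
    by rewrite -[X in measurable X]setTI; apply: measurable_dotp.
  apply: bigsetI_measurable => i _.
  by rewrite -[X in measurable X]setTI; apply: measurable_tnth.
by apply/(negligibleP _ mH); apply: hmu => //; exact: null_bounded_hyperplane.
Qed.

End NullHyperplane.

(** * Test integrals *)

Section Tests.

Variables (R : realType) (d : nat) (I : finType).
Variable mu : {finite_measure set (d.-tuple R) -> \bar R}.
Implicit Types (H : I -> hyperplane R d) (T : {set I}).

Definition side (h : hyperplane R d) (u : d.-tuple R) : R := Num.sg (dotp u h.1 - h.2).

Definition sides H T (u : d.-tuple R) : R := \prod_(i in T) side (H i) u.

Definition test H T : R := \int[mu]_u sides H T u.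

Lemma side_le1 h u : `|side h u| <= 1.
Proof. by rewrite normr_sg lern1 leq_b1. Qed.

Lemma sides_le1 H T u : `|sides H T u| <= 1.
Proof.
rewrite normr_prod.
suff /andP[] : 0 <= \prod_(i in T) `|side (H i) u| <= 1 by [].
elim/big_ind: _ => [|x y /andP[x0 x1] /andP[y0 y1]|i _].
- by rewrite ler01 lexx.
- by rewrite mulr_ge0 // mulr_ile1.
- by rewrite normr_ge0 side_le1.
Qed.

Lemma measurable_side h : measurable_fun setT (side h).
Proof.
have msg : measurable_fun setT (@Num.sg R).
  apply: nondecreasing_measurable => // x y xy.
  by case: (sgrP x) => hx; case: (sgrP y) => hy //; lra.
apply: (measurableT_comp msg); apply: measurable_funB; last exact: measurable_cst.
exact: measurable_dotp.
Qed.

Lemma measurable_sides H T : measurable_fun setT (sides H T).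
Proof.
rewrite /sides; under eq_fun do rewrite big_mkcond.
apply: measurable_prod => i _; case: (i \in T); [exact: measurable_side|exact: measurable_cst].
Qed.

Lemma integrable_sides H T : mu.-integrable setT (EFin \o sides H T).
Proof.
apply: measurable_bounded_integrable => //.
- exact: fin_num_fun_lty.
- exact: measurable_sides.
- exists 1; split => // x x1 u _; exact: le_trans (sides_le1 H T u) (ltW x1).
Qed.

Lemma testE H T : (\int[mu]_u (sides H T u)%:E = (test H T)%:E)%E.
Proof.
rewrite fineK //; exact: (integrable_fin_num _ (integrable_sides H T)).
Qed.

Lemma test_flip H H' T B : (forall i, i != B -> H' i = H i) ->
    (forall u, side (H' B) u = - side (H B) u) ->
  test H' T = if B \in T then - test H T else test H T.
Proof.
move=> HH HB; case: ifP => BT; last first.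
  congr Rintegral; apply/funext => u; apply: eq_bigr => i iT; rewrite HH //.
  by apply: contraFneq BT => <-.
rewrite -mulN1r -RintegralZl //; last exact: integrable_sides.
congr Rintegral; apply/funext => u; rewrite /sides !(bigD1 B BT) /= HB mulN1r mulNr.
by congr (- (_ * _)); apply: eq_bigr => i /andP[_ iB]; rewrite HH.
Qed.

Lemma sides_cvg (Hn : nat -> I -> hyperplane R d) H T u :
    (forall i, i \in T -> dotp u (H i).1 != (H i).2) ->
    (forall i k, tnth (Hn n i).1 k @[n --> \oo] --> tnth (H i).1 k) ->
    (forall i, (Hn n i).2 @[n --> \oo] --> (H i).2) ->
  sides (Hn n) T u @[n --> \oo] --> sides H T u.
Proof.
move=> Hu H1 H2.
have sd i : i \in T -> side (Hn n i) u @[n --> \oo] --> side (H i) u.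
  move=> iT; pose f n := dotp u (Hn n i).1 - (Hn n i).2.
  have fc : f n @[n --> \oo] --> dotp u (H i).1 - (H i).2.
    apply: cvgB; last exact: H2.
    rewrite /dotp; apply: (@cvg_big R _ +%R); [exact: add_continuous|move=> k _].
    by apply: cvgM; [exact: cvg_cst|exact: H1].
  apply: cvg_near_cst; have : dotp u (H i).1 - (H i).2 != 0 by rewrite subr_eq0 Hu.
  rewrite neq_lt => /orP[h|h].
    move/cvgr_lt: fc => /(_ _ h); apply: filterS => n fn.
    by rewrite /side (ltr0_sg h) (ltr0_sg fn).
  move/cvgr_gt: fc => /(_ _ h); apply: filterS => n fn.
  by rewrite /side (gtr0_sg h) (gtr0_sg fn).
by apply: (cvg_big (@mul_continuous _)) => i; exact: sd.
Qed.

(** Off the limiting hyperplanes the signs are eventually constant, so their products converge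
    almost everywhere. They are bounded by 1 and the mass is finite: dominated convergence
    applies. *)
Lemma test_cvg (Hn : nat -> I -> hyperplane R d) H T :
    (forall i, i \in T -> mu.-negligible [set u | dotp u (H i).1 = (H i).2]) ->
    (forall i k, tnth (Hn n i).1 k @[n --> \oo] --> tnth (H i).1 k) ->
    (forall i, (Hn n i).2 @[n --> \oo] --> (H i).2) ->
  test (Hn n) T @[n --> \oo] --> test H T.
Proof.
move=> Hnul H1 H2.
have ae_cvg : {ae mu, forall u, setT u -> (EFin \o sides (Hn n) T) u @[n --> \oo] -->
    (EFin \o sides H T) u}.
  have : mu.-negligible (\big[setU/set0]_(i in T) [set u | dotp u (H i).1 = (H i).2]).
    by elim/big_ind: _ => [|A B hA hB|i iT]; [exact: negligible_set0|exact: negligibleU|exact: Hnul].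
  apply: negligibleS => u /= hu; rewrite -bigcup_seq_cond.
  apply: contrapT => hn; apply: hu => _; apply: cvg_EFin; first exact: nearW.
  apply: sides_cvg => // i iT; apply/negP => /eqP e; apply: hn.
  by exists i => //=; rewrite mem_index_enum.
have ae_le : {ae mu, forall u n, setT u -> (`|(EFin \o sides (Hn n) T) u| <= (EFin \o cst 1%R) u)%E}.
  by apply: aeW => u n _; rewrite /= lee_fin; exact: sides_le1.
have [_ _ h] := @dominated_convergence _ _ R mu setT measurableT _ _ _
  (fun n => (measurable_EFinP _ _).2 (measurable_sides (Hn n) T))
  ((measurable_EFinP _ _).2 (measurable_sides H T)) ae_cvg
  (finite_measure_integrable_cst mu 1 measurableT) ae_le.
by apply: fine_cvg; rewrite -testE; apply: h.
Qed.

Lemma measurable_halfspace (h : hyperplane R d) b : measurable (halfspace h b).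
Proof.
have m X : measurable X -> measurable ((fun u : d.-tuple R => dotp u h.1) @^-1` X).
  by move=> mX; rewrite -[X in measurable X]setTI; apply: measurable_dotp.
case: b; rewrite /halfspace.
  rewrite (_ : [set u | _] = (fun u => dotp u h.1) @^-1` `[h.2, +oo[); first exact: m.
  by apply/seteqP; split => u /=; rewrite in_itv /= andbT.
rewrite (_ : [set u | _] = (fun u => dotp u h.1) @^-1` `]-oo, h.2]); first exact: m.
by apply/seteqP; split => u /=; rewrite in_itv.
Qed.

Lemma measurable_region H (S : {set I}) (s : I -> bool) :
  measurable [set u | forall i, i \in S -> halfspace (H i) (s i) u].
Proof.
have -> : [set u | forall i, i \in S -> halfspace (H i) (s i) u] =
    \big[setI/setT]_(i in S) halfspace (H i) (s i).
  rewrite -bigcap_seq_cond; apply/seteqP; split => u /= hu i.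
    by move=> /andP[_ iS]; exact: hu.
  by move=> iS; apply: hu; rewrite /= mem_index_enum.
by apply: bigsetI_measurable => i _; exact: measurable_halfspace.
Qed.

Lemma halfspace_side (h : hyperplane R d) b u : dotp u h.1 != h.2 ->
  (1 + (-1) ^+ (~~ b) * side h u) / 2 = (`[< halfspace h b u >])%:R.
Proof.
rewrite neq_lt /side => /orP[hu|hu]; [rewrite ltr0_sg ?subr_lt0 //|rewrite gtr0_sg ?subr_gt0 //].
- case: b => /=; [rewrite asboolF|rewrite asboolT ?ltW //]; last by rewrite expr1 /=; lra.
    by rewrite expr0 /=; lra.
  by apply/negP; rewrite -ltNge.
- case: b => /=; [rewrite asboolT ?ltW //|rewrite asboolF]; first by rewrite expr0 /=; lra.
    by rewrite expr1 /=; lra.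
  by apply/negP; rewrite -ltNge.
Qed.

(* Fourier inversion on (Z/2)^S: the indicator of a region is a combination of
   the products of sides, in which only the constant term has nonzero integral. *)
Lemma equipartition_tests H (S : {set I}) : abs_continuous mu ->
    (forall i, i \in S -> hp_nondeg (H i)) ->
    (forall T, T \subset S -> T != finset.set0 -> test H T = 0) ->
  equipartition H S mu.
Proof.
move=> hmu Hn H0 s.
have mA := measurable_region H S s; set A := [set u | _] in mA *.
pose e i : R := (-1) ^+ (~~ s i).
(* The coefficients obtained by expanding the product of the factors [(1 + e i * side (H i) u) / 2],
   extended by zero to all sets [J]. *)
pose c (J : {set I}) : R := if J \subset S then 2 ^- #|S| * \prod_(i in J) e i else 0.
have fE u : \sum_(J : {set I}) c J * sides H J u =
    \prod_(i in S) ((1 + e i * side (H i) u) / 2).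
  rewrite big_split /= prodr_const exprVn mulrC.
  have -> : \prod_(i in S) (1 + e i * side (H i) u) =
     \prod_i ((if i \in S then e i * side (H i) u else 0) + 1).
    rewrite big_mkcond; apply: eq_bigr => i _; case: ifP => _; first exact: addrC.
    by rewrite add0r.
  rewrite bigA_distr big_distrr /=; apply: eq_bigr => J _; rewrite /c.
  case: ifP => [JS|/negP JS].
    rewrite -mulrA -big_split /=; congr (_ * _).
    rewrite big_mkcond; apply: eq_bigr => i _; case: ifP => // iJ.
    by rewrite (fintype.subsetP JS).
  rewrite mul0r; have [i iJ iS] : exists2 i, i \in J & i \notin S.
    by apply/fintype.subsetPn/negP.
  by rewrite (bigD1 i) //= iJ (negbTE iS) mul0r mulr0.
(* Off the hyperplanes, each factor of the product is the indicator of a half-space. *)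
have ae_ind : ae_eq mu setT (fun u => (\1_A u)%:E)
    (fun u => (\sum_(J : {set I}) (c J * sides H J u)%:E)%E).
  have : mu.-negligible (\big[setU/set0]_(i in S) [set u | dotp u (H i).1 = (H i).2]).
    elim/big_ind: _ => [|B C hB hC|i iS]; [exact: negligible_set0|exact: negligibleU|].
    by apply: hyperplane_null => //; exact: Hn.
  apply: negligibleS => u /= hu; rewrite -bigcup_seq_cond.
  apply: contrapT => hn; apply: hu => _; rewrite sumEFin fE; congr EFin.
  rewrite (eq_bigr (fun i => (`[< halfspace (H i) (s i) u >])%:R)); last first.
    move=> i iS; apply: halfspace_side; apply/negP => /eqP hi; apply: hn.
    by exists i => //=; rewrite mem_index_enum.
  rewrite indicE; have [/set_mem uA|/negP uA] := boolP (u \in A).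
    by rewrite big1 // => i iS; rewrite asboolT //; exact: uA.
  have [i iS hi] : exists2 i, i \in S & ~ halfspace (H i) (s i) u.
    apply: contrapT => hh; apply: uA; apply: mem_set => i iS.
    by apply: contrapT => hi; apply: hh; exists i.
  by rewrite (bigD1 i) //= asboolF // mul0r.
have mS J : measurable_fun setT (fun u => (c J * sides H J u)%:E).
  apply/measurable_EFinP; apply: measurable_funM; first exact: measurable_cst.
  exact: measurable_sides.
have -> : mu A = (\int[mu]_u (\1_A u)%:E)%E by rewrite integral_indic // setIT.
have -> : (\int[mu]_u (\1_A u)%:E =
    \int[mu]_u (\sum_(J : {set I}) (c J * sides H J u)%:E))%E.
  apply: ae_eq_integral ae_ind => //; first by apply/measurable_EFinP; exact: measurable_indic.
  exact: emeasurable_sum.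
rewrite integral_sum //; last first.
  by move=> J; apply: (integrableZl _ (c J) (integrable_sides H J)).
have cE J : (\int[mu]_u (c J * sides H J u)%:E = (c J * test H J)%:E)%E.
  by under eq_integral do rewrite EFinM; rewrite integralZl ?testE //; exact: integrable_sides.
under eq_bigr do rewrite cE.
rewrite (bigD1 finset.set0) //= big1 ?adde0; last first.
  move=> J J0; rewrite /c; case: ifP => [JS|_]; last by rewrite mul0r.
  by rewrite H0 ?mulr0.
have -> : test H finset.set0 = fine (mu setT).
  rewrite /test; under eq_Rintegral do rewrite /sides finset.big_set0.
  by rewrite Rintegral_cst // mul1r.
rewrite /c finset.sub0set finset.big_set0 mulr1 EFinM fineK ?fin_num_measure // muleC.
by rewrite natrX.
Qed.

End Tests.

(** * The configuration space *)

Section Configuration.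

Variables (R : realType) (d : nat).

(* The free coordinates: the normal vector of H_i has its last i entries equal
   to zero, which leaves d - i of them. *)
Definition coord := {p : 'I_4 * 'I_d | (p.1 + p.2 < d)%N}.

Definition block (j : 'I_#|{: coord}|) : 'I_4 := (val (enum_val j)).1.

Definition normal (y : 'I_#|{: coord}| -> R) (i : 'I_4) (k : 'I_d) : R :=
  if insub (i, k) is Some x then y (enum_rank (x : coord)) else 0.

(* The cube [-1, 1]^(d-i) parametrizes an upper hemisphere of affine
   hyperplanes, its boundary being mapped to linear ones, where changing the
   sign of the normal exchanges the two sides. *)
Definition hplane (y : 'I_#|{: coord}| -> R) (i : 'I_4) : hyperplane R d :=
  ([tuple normal y i k | k < d], \prod_k (1 - normal y i k ^+ 2)).

Lemma card_block (B : 'I_4) : #|[set j | block j == B]%SET| = (d - B)%N.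
Proof.
have -> : [set j | block j == B]%SET =
    (enum_rank @: [set x : coord | (val x).1 == B])%SET.
  apply/setP => j; rewrite inE; apply/idP/imsetP => [h|[x]].
    by exists (enum_val j); rewrite ?inE // enum_valK.
  by rewrite inE => h ->; rewrite /block enum_rankK.
rewrite card_imset; last exact: enum_rank_inj.
have lt (k : 'I_(d - B)) : (k < d)%N by apply: leq_trans (ltn_ord k) (leq_subr _ _).
have ltB (k : 'I_(d - B)) : ((B, Ordinal (lt k)).1 + (B, Ordinal (lt k)).2 < d)%N.
  by have := ltn_ord k; rewrite /=; lia.
pose f k : coord := Sub (B, Ordinal (lt k)) (ltB k).
have fI : injective f by move=> k k' /(congr1 val) [] /val_inj.
rewrite -[RHS]card_ord -(card_imset _ fI); apply: eq_card => x; rewrite inE.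
apply/idP/imsetP => [/eqP xB|[k _ ->]]; last by rewrite /f SubK.
have hx := valP x; have xl : ((val x).2 < d - B)%N by move: hx; rewrite xB /=; lia.
exists (Ordinal xl) => //; apply: val_inj; rewrite SubK.
by case: (val x) xB {hx} xl => i k /= -> ?; congr (_, _); apply: val_inj.
Qed.

Lemma card_coord : (3 <= d)%N -> #|{: coord}| = (4 * d - 6)%N.
Proof.
move=> d3; rewrite -[LHS]card_ord -sum1_card.
rewrite (partition_big block xpredT) //= (eq_bigr (fun B : 'I_4 => d - B)%N).
  by rewrite !big_ord_recl big_ord0 /= /bump /=; lia.
by move=> B _; rewrite sum1dep_card -card_block; apply: eq_card => j; rewrite !inE.
Qed.

Lemma normal_flip B y i k :
  normal (flip block B y) i k = if i == B then - normal y i k else normal y i k.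
Proof.
rewrite /normal; case: insubP => [x _ xE|_]; last by case: ifP; rewrite ?oppr0.
by rewrite /flip /block enum_rankK xE.
Qed.

Lemma hplane_flip B y i : i != B -> hplane (flip block B y) i = hplane y i.
Proof.
move=> /negbTE iB; rewrite /hplane; congr (_, _).
  by apply: eq_from_tnth => k; rewrite !tnth_mktuple normal_flip iB.
by apply: eq_bigr => k _; rewrite normal_flip iB.
Qed.

Lemma side_hplane_flip y j u : `|y j| = 1 ->
  side (hplane (flip block (block j) y) (block j)) u = - side (hplane y (block j)) u.
Proof.
move=> yj; pose k := (val (enum_val j)).2.
have nk : normal y (block j) k = y j.
  rewrite /normal -surjective_pairing valK.
  by rewrite enum_valK.
have b0 : (hplane y (block j)).2 = 0.
  by rewrite /= (bigD1 k) //= nk -real_normK ?num_real // yj expr1n subrr mul0r.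
have b0' : (hplane (flip block (block j) y) (block j)).2 = 0.
  rewrite -[RHS]b0 /=; apply: eq_bigr => m _; rewrite normal_flip eqxx sqrrN //.
rewrite /side b0 b0' !subr0 -sgrN; congr Num.sg.
rewrite /dotp -sumrN; apply: eq_bigr => m _.
by rewrite !tnth_mktuple normal_flip eqxx mulrN.
Qed.

Lemma normal_cvg (u : nat -> 'I_#|{: coord}| -> R) y i k :
  (forall j, u n j @[n --> \oo] --> y j) -> normal (u n) i k @[n --> \oo] --> normal y i k.
Proof.
by move=> uy; rewrite /normal; case: insub => [x|]; [exact: uy|exact: cvg_cst].
Qed.

Lemma hplane2_cvg (u : nat -> 'I_#|{: coord}| -> R) y i :
  (forall j, u n j @[n --> \oo] --> y j) ->
  (hplane (u n) i).2 @[n --> \oo] --> (hplane y i).2.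
Proof.
move=> uy; apply: (@cvg_big R _ *%R) => [|k _]; first exact: mul_continuous.
by apply: cvgB; [exact: cvg_cst|apply: cvgM; exact: normal_cvg].
Qed.

Definition degenerate y i := [forall k, normal y i k == 0].

Lemma hplane_nondeg y i : ~~ degenerate y i -> hp_nondeg (hplane y i).
Proof. by move=> /forallPn[k hk]; exists k; rewrite tnth_mktuple. Qed.

(** A zero normal comes with offset 1, so the whole space lies strictly on the negative side. No
    point satisfies the equation, and the tests remain continuous at such parameters. *)
Lemma side_degenerate y i u : degenerate y i -> side (hplane y i) u = -1.
Proof.
move=> /forallP hi; rewrite /side /= /dotp !big1.
- by rewrite sub0r sgrN sgr1.
- by move=> k _; rewrite (eqP (hi k)) expr0n subr0.
- by move=> k _; rewrite tnth_mktuple (eqP (hi k)) mulr0.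
Qed.

Section Measure.

Variable mu : {finite_measure set (d.-tuple R) -> \bar R}.
Hypothesis mu_ac : abs_continuous mu.

Lemma hplane_negligible y i :
  mu.-negligible [set u | dotp u (hplane y i).1 = (hplane y i).2].
Proof.
have [hi|/hplane_nondeg hn] := boolP (degenerate y i); last exact: hyperplane_null.
apply: (negligibleS _ (negligible_set0 mu)) => u /= e.
have /eqP := side_degenerate u hi.
by rewrite /side e subrr sgr0 eq_sym oppr_eq0 oner_eq0.
Qed.

Lemma test_hplane_cvg (u : nat -> 'I_#|{: coord}| -> R) y T :
  (forall j, u n j @[n --> \oo] --> y j) ->
  test mu (hplane (u n)) T @[n --> \oo] --> test mu (hplane y) T.
Proof.
move=> uy; apply: test_cvg => [i _|i k|i]; first exact: hplane_negligible.
  rewrite tnth_mktuple; under eq_fun do rewrite tnth_mktuple.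
  exact: normal_cvg.
exact: hplane2_cvg.
Qed.

Lemma test_hplane_flip y j T : `|y j| = 1 ->
  test mu (hplane (flip block (block j) y)) T =
  if block j \in T then - test mu (hplane y) T else test mu (hplane y) T.
Proof.
move=> yj; apply: test_flip => [i|u]; first exact: hplane_flip.
exact: side_hplane_flip.
Qed.

Lemma test_degenerate y i : degenerate y i -> test mu (hplane y) [set i]%SET = 0 ->
  mu setT = 0%E.
Proof.
move=> hi; rewrite /test.
under eq_Rintegral do rewrite /sides finset.big_set1 side_degenerate //.
rewrite Rintegral_cst // mulN1r => /eqP; rewrite oppr_eq0 => /eqP h.
by rewrite -[mu setT]fineK ?fin_num_measure // h.
Qed.

Lemma equipartition0 (H : 'I_4 -> hyperplane R d) S : mu setT = 0%E -> equipartition H S mu.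
Proof.
move=> m0 s; rewrite m0 mul0e; apply/eqP; rewrite eq_le measure_ge0 andbT -m0.
by apply: le_measure; rewrite ?inE //; exact: measurable_region.
Qed.

(** A degenerate member is replaced by an arbitrary genuine hyperplane. If the tests of a mass
    vanish for a set containing that member, the test of the member alone is minus the total mass;
    the mass is then zero and is equipartitioned by anything. *)
Definition regular_hplane y i : hyperplane R d :=
  if degenerate y i then ([tuple 1 | k < d], 0) else hplane y i.

Lemma regular_hplane_nondeg y i : (0 < d)%N -> hp_nondeg (regular_hplane y i).
Proof.
move=> d0; rewrite /regular_hplane; case: ifPn => [_|]; last exact: hplane_nondeg.
by exists (Ordinal d0); rewrite tnth_mktuple oner_eq0.
Qed.

Lemma regular_equipartition y (S : {set 'I_4}) : (0 < d)%N ->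
    (forall T : {set 'I_4}, T \subset S -> T != finset.set0 -> test mu (hplane y) T = 0) ->
  equipartition (regular_hplane y) S mu.
Proof.
move=> d0 h0; have [[i iS hi]|hS] := pselect (exists2 i, i \in S & degenerate y i).
  apply/equipartition0/(test_degenerate hi)/h0; first by rewrite finset.sub1set.
  by apply/set0Pn; exists i; rewrite finset.in_set1.
apply: equipartition_tests => // [i iS|T TS T0]; first exact: regular_hplane_nondeg.
rewrite -[RHS](h0 T) //; congr Rintegral; apply/funext => u; apply: eq_bigr => i iT.
rewrite /regular_hplane ifN //; apply/negP => hi; apply: hS; exists i => //.
exact: (fintype.subsetP TS).
Qed.

End Measure.

End Configuration.

(** * From the common zero to the equipartitions *)

Lemma set_seq_forms (T : {set 'I_4}) : T != finset.set0 -> (#|T| <= 3)%N ->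
  exists2 A, A \in triple_forms ++ pair_forms &
    [set B : 'I_4 | (B : nat) \in A]%SET = T /\
    (ord0 \notin T -> (#|T| <= 2)%N -> A \in pair_forms).
Proof.
pose o m (h : (m < 4)%N) := Ordinal h.
(* The four membership bits of [T] reduce the claims to a finite case analysis. *)
pose bs := [:: o 0 isT \in T; o 1 isT \in T; o 2 isT \in T; o 3 isT \in T].
have mT (B : 'I_4) : (B \in T) = nth false bs B.
  case: B => -[|[|[|[|//]]]] h /=; rewrite /o /=;
  by congr (_ \in T); apply: val_inj.
have cT : #|T| = (\sum_(b <- bs) b)%N.
  rewrite -sum1_card big_mkcond /= !big_ord_recl big_ord0 !mT /= !big_cons big_nil.
  by do 4!case: (_ \in T).
have [B0 _|T0] := pickP (mem T); last first.
  by move/set0Pn => [B]; rewrite -[B \in T]/(mem T B) T0.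
pose A := [seq i <- iota 0 4 | nth false bs i].
move=> Tn0 T3; exists A; last split.
- move: Tn0 T3; rewrite -finset.card_gt0 cT /A /= !big_cons big_nil.
  by do 4!case: (_ \in T).
- apply/setP => B; rewrite inE mem_filter mT mem_iota /= ltn_ord andbT.
  by case: (nth _ _ _).
- rewrite (mT ord0) /=; move: Tn0 T3; rewrite -finset.card_gt0 cT /A /= !big_cons big_nil.
  by do 4!case: (_ \in T).
Qed.

Theorem theorem4p1 (R : realType) (q t : nat) (ht1 : (1 <= t)%N)
  (ht2 : (t <= 2 ^ q)%N)
  (mu : 'I_(2 ^ q.+1 - 1) -> {finite_measure set ((7 * 2 ^ q - 2 * t).-tuple R) -> \bar R})
  (hmu : forall k, abs_continuous (mu k))
  (P : {set 'I_(2 ^ q.+1 - 1)}) (hP : #|P| = (2 ^ q.+1 - t)%N) :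
  exists H : 'I_4 -> hyperplane R (7 * 2 ^ q - 2 * t),
    (forall i, hp_nondeg (H i)) /\
    (forall k, k \in P -> forall S : {set 'I_4}, #|S| = 3%N ->
        equipartition H S (mu k)) /\
    (forall k, k \notin P -> forall S : {set 'I_4}, #|S| = 2%N -> ord0 \notin S ->
        equipartition H S (mu k)).
Proof.
have q2 : (2 ^ q.+1 = (2 ^ q).*2)%N by rewrite expnS mul2n.
set K := (2 ^ q.+1 - 1)%N in mu hmu P hP *.
set d := (7 * 2 ^ q - 2 * t)%N in mu hmu *.
have K0 : (0 < K)%N by rewrite /K q2; lia.
have d5 : (5 <= d)%N by rewrite /d; lia.
(* One entry per equation: a mass and the indices of the hyperplanes whose signs are multiplied.
   Their number turns out to be that of the free coordinates, [4 * d - 6]. *)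
pose L := [seq (k, A) | k <- enum P, A <- triple_forms ++ pair_forms] ++
          [seq (k, A) | k <- enum (~: P)%SET, A <- pair_forms].
pose ss := [seq p.2 | p <- L].
have PC : (#|(~: P)%SET| = t - 1)%N.
  have : (2 ^ q.+1 - t + #|(~: P)%SET| = 2 ^ q.+1 - 1)%N.
    by rewrite -hP finset.cardsC card_ord.
  by move: #|_| => c; rewrite q2; lia.
have ca (X : {set 'I_K}) (u : seq (seq nat)) (a : pred (seq nat)) :
    count a [seq p.2 | p <- [seq (k, A) | k <- enum X, A <- u]] = (#|X| * count a u)%N.
  rewrite cardE; elim: (enum X) => //= k s IH.
  by rewrite map_cat count_cat IH -map_comp (eq_map (g := id)) // map_id mulSn.
have cf a m (u : seq (seq nat)) : count a (flatten (nseq m u)) = (m * count a u)%N.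
  by elim: m => //= m IH; rewrite count_cat IH mulSn.
have ss_perm : perm_eq ss (forms (2 ^ q.+1 - t) (2 ^ q.+1 - 1)).
  apply/seq.permP => a; rewrite /ss /L map_cat !count_cat !ca !cf count_cat PC hP.
  move: (count a triple_forms) (count a pair_forms) => u v.
  rewrite mulnDr -addnA -mulnDl; congr (_ + _ * _)%N; rewrite q2; lia.
have sz : size ss = #|{: coord d}|.
  rewrite card_coord; last by lia.
  rewrite (perm_size ss_perm) -[LHS]count_predT count_cat !cf !count_predT /=.
  rewrite /d q2; lia.
have hodd : odd #|words (@block d) (fun l => [set B : 'I_4 | (B : nat) \in nth [::] ss l]%SET)|.
  (* Counted down from [d], the exponents (0, 1, 2, 3) are the block sizes [d], [d - 1], [d - 2],
     [d - 3]; both tables are true there. *)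
  rewrite (@odd_words _ _ _ d (0, 1, 2, 3)%N sz) => [|B]; last first.
    rewrite card_block; suff -> : qnth (0, 1, 2, 3)%N B = B by have := ltn_ord B; lia.
    by case: B => -[|[|[|[|]]]].
  rewrite (perm_lprod _ ss_perm).
  have [|rho ->] := @table_forms q t; [by rewrite ht1|by case: rho|by []].
pose p0 := (Ordinal K0, [::] : seq nat).
pose F l (y : 'I_#|{: coord d}| -> R) :=
  test (mu (nth p0 L l).1) (hplane y) [set B : 'I_4 | (B : nat) \in nth [::] ss l]%SET.
have [| |y hy] := @borsuk_ulam R _ _ (@block d) _ F _ _ hodd.
- by move=> l _ u y uy; exact: test_hplane_cvg.
- by move=> l _ y i yi; rewrite /F test_hplane_flip.
have test0 k A : (k, A) \in L -> test (mu k) (hplane y) [set B : 'I_4 | (B : nat) \in A]%SET = 0.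
  move=> kL; have lL : (index (k, A) L < size L)%N by rewrite index_mem.
  have := hy (index (k, A) L); rewrite /F -sz size_map => /(_ lL).
  by rewrite (nth_map p0) // nth_index.
exists (regular_hplane y); split; first by move=> i; apply: regular_hplane_nondeg; lia.
split => [k kP S S3|k kP S S2 S0].
- apply: regular_equipartition => // [|T TS T0]; first by lia.
  have [|A hA [<- _]] := set_seq_forms T0; first by apply: leq_trans (subset_leq_card TS) _; rewrite S3.
  by apply: test0; rewrite mem_cat allpairs_f ?mem_enum.
- apply: regular_equipartition => // [|T TS T0]; first by lia.
  have T2 : (#|T| <= 2)%N by apply: leq_trans (subset_leq_card TS) _; rewrite S2.
  have [|A _ [TA hA]] := set_seq_forms T0; first exact: leq_trans T2 _.
  have Ap : A \in pair_forms.
    by apply: hA T2; apply: contra S0; exact: (fintype.subsetP TS).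
  by rewrite -TA; apply: test0; rewrite mem_cat (allpairs_f _ _ Ap) ?orbT ?mem_enum ?inE.
Qed.
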